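(* Let $(B,g_B)$ and $(F,g_F)$ be semi-regular semi-Riemannian manifolds, let $f\in C^\infty(B)$ be a smooth function such that $df\in\mathscr A^{\bullet 1}(B)$, and let $B\times_f F$ be the degenerate warped product, with Riemann curvature tensor $R$. Let $R_B,R_F$ be the lifts to $B\times F$ of the Riemann curvature tensors of $B$ and $F$, and let $H^f$ be the Hessian of $f$ (which exists because $df\in\mathscr A^{\bullet 1}(B)$). Let $X,Y,Z,T$ be vector fields on $B\times F$ that are lifts of vector fields on $B$, and $U,V,W,Q$ vector fields on $B\times F$ that are lifts of vector fields on $F$. Then: \begin{enumerate} \item $R(X,Y,Z,T)=R_B(X,Y,Z,T)$; \item $R(X,Y,Z,Q)=0$; \item $R(X,Y,W,Q)=0$; \item $R(U,V,Z,Q)=0$; \item $R(X,V,W,T)=-f\,H^f(X,T)\,\langle V,W\rangle_F$; \item $R(U,V,W,Q)=R_F(U,V,W,Q)+f^2\,\langle\!\langle df,df\rangle\!\rangle_{\bullet B}\big(\langle U,W\rangle_F\langle V,Q\rangle_F-\langle V,W\rangle_F\langle U,Q\rangle_F\big)$; \end{enumerate} the other cases being obtained by the symmetries of the Riemann curvature tensor.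
   Context: A singular semi-Riemannian manifold $(M,g)$ is a differentiable manifold $M$ with a smooth symmetric bilinear form $g=\langle\cdot,\cdot\rangle$ on $TM$ (called the metric), which may be degenerate and may have variable signature. $\mathfrak X(M)$ denotes the smooth vector fields on $M$. For $p\in M$, $(T_pM)^\bullet\subseteq T_p^*M$ is the space of covectors of the form $\langle Y_p,\cdot\rangle$ with $Y_p\in T_pM$. $\mathcal A^\bullet(M)$ is the set of smooth $1$-forms $\omega$ on $M$ with $\omega_p\in(T_pM)^\bullet$ for every $p\in M$. On $(T_pM)^\bullet$ there is a unique non-degenerate inner product given by $\langle\!\langle\omega,\tau\rangle\!\rangle_\bullet:=\langle X,Y\rangle$, where $\omega=\langle X,\cdot\rangle$ and $\tau=\langle Y,\cdot\rangle$; for $M=B$ it is written $\langle\!\langle\cdot,\cdot\rangle\!\rangle_{\bullet B}$. The Koszul form of $(M,g)$ is, for $X,Y,Z\in\mathfrak X(M)$, $$\mathcal K(X,Y,Z):=\tfrac12\{X\langle Y,Z\rangle+Y\langle Z,X\rangle-Z\langle X,Y\rangle-\langle X,[Y,Z]\rangle+\langle Y,[Z,X]\rangle+\langle Z,[X,Y]\rangle\}.$$ The lower covariant derivative $\nabla^\flat_XY$ is the $1$-form $(\nabla^\flat_XY)(Z):=\mathcal K(X,Y,Z)$. $(M,g)$ is radical-stationary if $\nabla^\flat_XY\in\mathcal A^\bullet(M)$ for all $X,Y\in\mathfrak X(M)$. If $(M,g)$ is radical-stationary, $X\in\mathfrak X(M)$ and $\omega\in\mathcal A^\bullet(M)$,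 the covariant derivative of $\omega$ in the direction of $X$ is $$(\nabla_X\omega)(Y):=X(\omega(Y))-\langle\!\langle\nabla^\flat_XY,\omega\rangle\!\rangle_\bullet ,$$ which is a $1$-form that is smooth on the regions of constant signature of $g$. Set $$\mathscr A^{\bullet 1}(M):=\{\omega\in\mathcal A^\bullet(M)\mid\nabla_X\omega\in\mathcal A^\bullet(M)\text{ for all }X\in\mathfrak X(M)\}.$$ A semi-regular semi-Riemannian manifold is a (radical-stationary) singular semi-Riemannian manifold $(M,g)$ with $\nabla^\flat_XY\in\mathscr A^{\bullet 1}(M)$ for all $X,Y\in\mathfrak X(M)$. The Riemann curvature tensor is $$R(X,Y,Z,T):=\big(\nabla_X\nabla^\flat_YZ-\nabla_Y\nabla^\flat_XZ-\nabla^\flat_{[X,Y]}Z\big)(T).$$ On a semi-regular manifold $(M,g)$, the Hessian of $f\in C^\infty(M)$ with $df\in\mathscr A^{\bullet 1}(M)$ is the smooth tensor field $H^f(X,Y):=(\nabla_X df)(Y)$; in the claim it is taken on $B$ and lifted to $B\times F$. Degenerate warped product: given singular semi-Riemannian manifolds $(B,g_B)$, $(F,g_F)$ and $f\in C^\infty(B)$ (which is allowed to vanish or become negative), $B\times_f F$ is the manifold $B\times F$ with metric $\pi_B^*g_B+(f\circ\pi_B)^2\,\pi_F^*g_F$, where $\pi_B:B\times F\to B$ and $\pi_F:B\times F\to F$ are the canonical projections. Lifts: the lift of a vector field $X_B$ on $B$ is the unique vector field on $B\times F$ that projects to $X_B$ under $d\pi_B$ and is tangent to the submanifolds $B\times\{q\}$,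 $q\in F$; similarly for lifts from $F$. Functions and covariant tensors on $B$ or $F$ are lifted to $B\times F$ by pullback along the projections, and the same symbol is used for the lift. For lifts $V,W$ of $V_F,W_F\in\mathfrak X(F)$, $\langle V,W\rangle_F$ is the pullback of $g_F(V_F,W_F)$.
   Formalization: Item 6 is proved with f² R_F in place of R_F (the printed formula fails for constant f = 2). Item 5 is proved at points where f ≠ 0 or df = 0, with its right side shown smooth; where f = 0 and df ≠ 0 it fails, e.g. for dx² + x² dy² at x = 0. *)

(* Defs.v *)
From HB Require Import structures.
From mathcomp Require Import all_boot all_order all_algebra.
From mathcomp Require Import zify.
From mathcomp Require Import all_classical all_reals all_analysis.

Set Implicit Arguments.
Unset Strict Implicit.
Unset Printing Implicit Defensive.

Import Order.TTheory GRing.Theory Num.Theory.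
Import numFieldNormedType.Exports.

Local Open Scope classical_set_scope.
Local Open Scope ring_scope.

Section Calculus.
Context {R : realType}.

Definition partial n (j : 'I_n) (u : 'rV[R]_n -> R) : 'rV[R]_n -> R :=
  'D_(delta_mx 0 j) u.

(* Differentiability is required, not only the existence of the partial
   derivatives; U is always open. *)
Fixpoint Ck (k : nat) n (U : set 'rV[R]_n) (u : 'rV[R]_n -> R) : Prop :=
  match k with
  | 0 => forall x, U x -> {for x, continuous u}
  | k'.+1 => (forall x, U x -> differentiable u x) /\
             forall j, Ck k' U (partial j u)
  end.

Definition Cinf n (U : set 'rV[R]_n) (u : 'rV[R]_n -> R) : Prop :=
  forall k, Ck k U u.

Lemma line_cvg n (x d : 'rV[R]_n) :
  (fun h : R => h *: d + x) @ (0 : R)^' --> x.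
Proof.
have H : {for (0 : R), continuous (fun h : R => h *: d + x)}.
  apply: continuousD; last exact: cst_continuous.
  exact: scalel_continuous.
by move/continuous_withinNx: H; rewrite scale0r add0r.
Qed.

Lemma near_eq_derive n (u v : 'rV[R]_n -> R) (x d : 'rV[R]_n) :
  (\forall y \near x, u y = v y) -> 'D_d u x = 'D_d v x.
Proof.
move=> uv; rewrite /derive.
have uvx : u x = v x by exact: nbhs_singleton uv.
have H : \forall h \near (0 : R)^', u (h *: d + x) = v (h *: d + x).
  exact: line_cvg d _ uv.
by congr (lim _); apply/seteqP; split; apply: near_eq_cvg;
  apply: filterS H => h /= ->; rewrite uvx.
Qed.

Lemma near_eq_differentiable n (u v : 'rV[R]_n -> R) (x : 'rV[R]_n) :
  (\forall y \near x, u y = v y) -> differentiable u x -> differentiable v x.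
Proof.
move=> uv du.
have cu : continuous ('d u x) by exact: diff_continuous.
have uvx : u x = v x by exact: nbhs_singleton uv.
have dv : v \o shift x = cst (v x) + 'd u x +o_ (0 : 'rV[R]_n) id.
  have := diff_locally du; rewrite -uvx => /eqaddoP H.
  apply/eqaddoP => e e0; move: (H e e0) => {}H.
  have uv0 : \forall y \near (0 : 'rV[R]_n), u (y + x) = v (y + x).
    by move: uv; rewrite (near_shift 0) /= subr0.
  near=> y.
  have <- : (u \o shift x - (cst (u x) + 'd u x)) y
         = (v \o shift x - (cst (u x) + 'd u x)) y.
    rewrite /= !fctE /=; congr (_ - _); near: y; exact: uv0.
  by near: y.
by apply/diff_locallyP; rewrite (diff_unique cu dv).
Unshelve. all: by end_near. Qed.

Lemma Ck_ext k n (U : set 'rV[R]_n) (u v : 'rV[R]_n -> R) :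
  open U -> {in U, u =1 v} -> Ck k U u -> Ck k U v.
Proof.
elim: k u v => [|k IHk] u v oU uv /=.
  move=> cu x Ux.
  have nUx : \forall y \near x, u y = v y.
    by apply: filterS (open_nbhs_nbhs (conj oU Ux)) => y Uy; apply: uv; rewrite inE.
  have uvx : u x = v x by exact: nbhs_singleton nUx.
  have := cu x Ux; rewrite /prop_for /continuous_at uvx => cux.
  exact: cvg_trans (near_eq_cvg nUx) cux.
have nU x : U x -> \forall y \near x, u y = v y.
  move=> Ux.
  by apply: filterS (open_nbhs_nbhs (conj oU Ux)) => y Uy; apply: uv; rewrite inE.
move=> [du pu]; split=> [x Ux|j].
  exact: near_eq_differentiable (nU x Ux) (du x Ux).
apply: IHk (pu j) => // x; rewrite inE => Ux.
exact: near_eq_derive (nU x Ux).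
Qed.

Lemma CkS k n (U : set 'rV[R]_n) (u : 'rV[R]_n -> R) :
  Ck k.+1 U u -> Ck k U u.
Proof.
elim: k u => [|k IHk] u [du pu].
  by move=> x Ux; exact: differentiable_continuous (du x Ux).
by split=> // j; apply: IHk; exact: pu.
Qed.

Lemma Ck_sub k n (U V : set 'rV[R]_n) (u : 'rV[R]_n -> R) :
  V `<=` U -> Ck k U u -> Ck k V u.
Proof.
move=> VU; elim: k u => [|k IHk] u /=; first by move=> cu x /VU; exact: cu.
by move=> [du pu]; split=> [x /VU|j]; [exact: du|exact: IHk].
Qed.

Lemma Ck_cst k n (U : set 'rV[R]_n) (a : R) : Ck k U (cst a).
Proof.
elim: k a => [|k IHk] a /=; first by move=> x _; exact: cst_continuous.
split=> [x _|j]; first exact: differentiable_cst.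
rewrite (_ : partial _ _ = cst 0) //.
by apply/funext => x; rewrite /partial /= derive_cst.
Qed.

Lemma Ck_add k n (U : set 'rV[R]_n) (u v : 'rV[R]_n -> R) :
  open U -> Ck k U u -> Ck k U v -> Ck k U (fun x => u x + v x).
Proof.
move=> oU; elim: k u v => [|k IHk] u v /=.
  by move=> cu cv x Ux; apply: continuousD; [exact: cu|exact: cv].
move=> [du pu] [dv pv]; split=> [x Ux|j].
  by apply: differentiableD; [exact: du|exact: dv].
apply: Ck_ext (IHk _ _ (pu j) (pv j)) => // x; rewrite inE => Ux.
by rewrite /partial deriveD//; apply: diff_derivable; [exact: du|exact: dv].
Qed.

Lemma Ck_mul k n (U : set 'rV[R]_n) (u v : 'rV[R]_n -> R) :
  open U -> Ck k U u -> Ck k U v -> Ck k U (fun x => u x * v x).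
Proof.
move=> oU; elim: k u v => [|k IHk] u v /=.
  by move=> cu cv x Ux; apply: continuousM; [exact: cu|exact: cv].
move=> Cu Cv; have [du pu] := Cu; have [dv pv] := Cv; split=> [x Ux|j].
  by apply: differentiableM; [exact: du|exact: dv].
have Cuv := IHk _ _ (CkS Cu) (pv j).
have Cvu := IHk _ _ (CkS Cv) (pu j).
apply: Ck_ext (Ck_add oU Cuv Cvu) => // x; rewrite inE => Ux.
by rewrite /partial deriveM//; apply: diff_derivable; [exact: du|exact: dv].
Qed.

Lemma derive_comp_linear m n (L : {linear 'rV[R]_m -> 'rV[R]_n})
    (u : 'rV[R]_n -> R) (x d : 'rV[R]_m) :
  'D_d (u \o L) x = 'D_(L d) u (L x).
Proof.
rewrite /derive; set F := fun h : R => _; set G := fun h : R => _.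
by have -> : F = G by apply/funext => h; rewrite /F /G /= linearP.
Qed.

Lemma Ck_comp_linear k m n (L : {linear 'rV[R]_m -> 'rV[R]_n})
    (U : set 'rV[R]_n) (u : 'rV[R]_n -> R) :
  continuous L ->
  (forall j, L (delta_mx 0 j) = 0 \/ exists i, L (delta_mx 0 j) = delta_mx 0 i) ->
  Ck k U u -> Ck k (L @^-1` U) (u \o L).
Proof.
move=> cL Ld; elim: k u => [|k IHk] u /=.
  move=> cu x Ux; have cLx := cL x; have cux := cu (L x) Ux.
  exact: (@continuous_comp 'rV[R]_m 'rV[R]_n R L u x cLx cux).
move=> [du pu]; split=> [x Ux|j].
  apply: (@differentiable_comp _ _ _ _ L u); last exact: du.
  exact: linear_differentiable.
have [Lj0|[i Lji]] := Ld j.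
  rewrite (_ : partial _ _ = cst 0); first exact: Ck_cst.
  by apply/funext => x; rewrite /partial derive_comp_linear Lj0 derive0.
rewrite (_ : partial _ _ = partial i u \o L); first exact: IHk.
by apply/funext => x; rewrite /partial derive_comp_linear Lji.
Qed.

Lemma lsubmx_delta m n (j : 'I_(m + n)) :
  lsubmx (delta_mx 0 j : 'rV[R]_(m + n)) =
  match fintype.split j with inl i => delta_mx 0 i | inr _ => 0 end.
Proof.
apply/rowP => i; rewrite !mxE; case: fintype.splitP => k jk; rewrite !mxE !eqxx /=.
  congr (_%:R); congr nat_of_bool.
  by rewrite -!val_eqE /= jk.
by rewrite -val_eqE /= jk; case: eqP => // ik; have := ltn_ord i; rewrite ik; lia.
Qed.

Lemma rsubmx_delta m n (j : 'I_(m + n)) :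
  rsubmx (delta_mx 0 j : 'rV[R]_(m + n)) =
  match fintype.split j with inl _ => 0 | inr i => delta_mx 0 i end.
Proof.
apply/rowP => i; rewrite !mxE; case: fintype.splitP => k jk; rewrite !mxE !eqxx /=.
  by rewrite -val_eqE /= jk; case: eqP => // ik; have := ltn_ord k; rewrite -ik; lia.
congr (_%:R); congr nat_of_bool.
by rewrite -!val_eqE /= jk eqn_add2l.
Qed.

Lemma Ck_lsubmx k m n (U : set 'rV[R]_m) (u : 'rV[R]_m -> R) :
  Ck k U u -> Ck k ((@lsubmx R 1 m n) @^-1` U) (u \o lsubmx).
Proof.
apply: (@Ck_comp_linear _ _ _ (@lsubmx R 1 m n)); first exact: continuous_lsubmx.
by move=> j /=; rewrite lsubmx_delta; case: fintype.split => i; [right; exists i|left].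
Qed.

Lemma Ck_rsubmx k m n (U : set 'rV[R]_n) (u : 'rV[R]_n -> R) :
  Ck k U u -> Ck k ((@rsubmx R 1 m n) @^-1` U) (u \o rsubmx).
Proof.
apply: (@Ck_comp_linear _ _ _ (@rsubmx R 1 m n)); first exact: continuous_rsubmx.
by move=> j /=; rewrite rsubmx_delta; case: fintype.split => i; [left|right; exists i].
Qed.

End Calculus.

(* The atlas is indexed by the points of the manifold: [chart c] is a chart
   whose domain [chart_dom c] contains [c].  Any atlas can be indexed this way
   (choose, for each point, a chart around it; the chosen charts form an atlas
   of the same smooth structure).  [chart c] and [param c] are total functions,
   meaningful only on [chart_dom c] and on its image [chart_img c]. *)
Record manifold (R : realType) := Manifold {
  mcarrier :> topologicalType;
  mdim : nat;
  chart_dom : mcarrier -> set mcarrier;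
  chart : mcarrier -> mcarrier -> 'rV[R]_mdim;
  param : mcarrier -> 'rV[R]_mdim -> mcarrier;
  mhausdorff : hausdorff_space mcarrier;
  msecond_countable : @second_countable mcarrier;
  chart_dom_open : forall c, open (chart_dom c);
  chart_dom_center : forall c, chart_dom c c;
  chart_img_open : forall c, open (chart c @` chart_dom c);
  chartK : forall c, {in chart_dom c, cancel (chart c) (param c)};
  chart_continuous : forall c p, chart_dom c p -> {for p, continuous (chart c)};
  param_continuous : forall c x, (chart c @` chart_dom c) x ->
    {for x, continuous (param c)};
  chart_transition : forall c d j,
    Cinf (chart c @` (chart_dom c `&` chart_dom d))
         (fun x => chart d (param c x) 0 j)
}.

Definition chart_img (R : realType) (M : manifold R) (c : M) :=
  chart c @` chart_dom c.

(* [T_p M] is identified with R^n by means of the chart [chart p]: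
   [v : 'rV[R]_(mdim M)] stands for the sum of the v_i d/dx^i at p, where the
   x^i are the coordinates of [chart p]. *)
Definition vfield (R : realType) (M : manifold R) := M -> 'rV[R]_(mdim M).

Section Manifold.
Context {R : realType} (M : manifold R).
Implicit Types (p c : M) (h : M -> R) (X Y : vfield M).

Definition coord c (i : 'I_(mdim M)) : M -> R := fun p => chart c p 0 i.

Definition smooth_fun h :=
  forall c, Cinf (chart_img c) (h \o param c).

Definition vderiv p (v : 'rV[R]_(mdim M)) h : R :=
  \sum_i v 0 i * partial i (h \o param p) (chart p p).

Definition deriv X h : M -> R := fun p => vderiv p (X p) h.

Definition smooth_vf X :=
  forall c i, Cinf (chart_img c) (deriv X (coord c i) \o param c).

(* d/dx^i at p, for the coordinates x^i of [chart c], p in [chart_dom c] *)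
Definition frame c (i : 'I_(mdim M)) p : 'rV[R]_(mdim M) :=
  \row_j partial i (coord p j \o param c) (chart c p).

(* In the coordinates of [chart p]: [X, Y]^i = X (Y^i) - Y (X^i). *)
Definition bracket X Y : vfield M := fun p =>
  \row_i (deriv X (deriv Y (coord p i)) p - deriv Y (deriv X (coord p i)) p).

End Manifold.

Definition differential (R : realType) (M N : manifold R) (phi : M -> N)
    (p : M) (v : 'rV[R]_(mdim M)) : 'rV[R]_(mdim N) :=
  \row_j vderiv p v (coord (phi p) j \o phi).

Record srmanifold (R : realType) := SRManifold {
  srcarrier :> manifold R;
  metric : forall p : srcarrier,
    'rV[R]_(mdim srcarrier) -> 'rV[R]_(mdim srcarrier) -> R;
  metric_sym : forall p v w, metric p v w = metric p w v;
  metric_linear : forall p v, scalar (metric p v);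
  metric_smooth : forall c i j, Cinf (chart_img c)
    ((fun p => metric p (frame c i p) (frame c j p)) \o param c)
}.

Section SemiRiemannian.
Context {R : realType} (M : srmanifold R).
Local Notation form := (vfield M -> M -> R).
Implicit Types (p : M) (h : M -> R) (X Y Z T : vfield M) (omega tau : form).

Definition ip X Y : M -> R := fun p => metric p (X p) (Y p).

Definition koszul X Y Z : M -> R := fun p =>
  2^-1 * (deriv X (ip Y Z) p + deriv Y (ip Z X) p - deriv Z (ip X Y) p
          - ip X (bracket Y Z) p + ip Y (bracket Z X) p + ip Z (bracket X Y) p).

(* A 1-form is seen as a C^oo(M)-linear map from vector fields to functions;
   only its values on smooth vector fields are meaningful. *)
Definition smooth_form omega : Prop :=
  (forall Z, smooth_vf Z -> smooth_fun (omega Z)) /\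
  (forall (a : M -> R) Z T, smooth_fun a -> smooth_vf Z -> smooth_vf T ->
     forall p, omega (fun q => a q *: Z q + T q) p = a p * omega Z p + omega T p).

Definition represents p (v : 'rV[R]_(mdim M)) omega : Prop :=
  forall Z, smooth_vf Z -> omega Z p = metric p v (Z p).

Definition bullet omega : Prop :=
  smooth_form omega /\ forall p, exists v, represents p v omega.

(* The chosen representatives are irrelevant as soon as both covectors at p
   belong to (T_p M)^bullet; otherwise the value is meaningless. *)
Definition bullet_ip omega tau : M -> R := fun p =>
  metric p (xget 0 [set v | represents p v omega])
           (xget 0 [set v | represents p v tau]).

Definition nabla_flat X Y : form := fun Z => koszul X Y Z.

Definition radical_stationary : Prop :=
  forall X Y, smooth_vf X -> smooth_vf Y -> bullet (nabla_flat X Y).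

Definition nabla X omega : form := fun Y p =>
  deriv X (omega Y) p - bullet_ip (nabla_flat X Y) omega p.

Definition bullet1 omega : Prop :=
  bullet omega /\ forall X, smooth_vf X -> bullet (nabla X omega).

Definition semi_regular : Prop :=
  radical_stationary /\
  forall X Y, smooth_vf X -> smooth_vf Y -> bullet1 (nabla_flat X Y).

Definition riemann X Y Z T : M -> R := fun p =>
  nabla X (nabla_flat Y Z) T p - nabla Y (nabla_flat X Z) T p
  - nabla_flat (bracket X Y) Z T p.

Definition dform h : form := fun Z => deriv Z h.

Definition hessian h X Y : M -> R := fun p => nabla X (dform h) Y p.

End SemiRiemannian.

Section Product.
Context {R : realType} (B F : manifold R).

Local Notation PT := (B * F)%type.

Definition prod_dom (c : PT) : set PT := chart_dom c.1 `*` chart_dom c.2.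

Definition prod_chart (c z : PT) : 'rV[R]_(mdim B + mdim F) :=
  row_mx (chart c.1 z.1) (chart c.2 z.2).

Definition prod_param (c : PT) (x : 'rV[R]_(mdim B + mdim F)) : PT :=
  (param c.1 (lsubmx x), param c.2 (rsubmx x)).

Lemma prod_hausdorff : hausdorff_space PT.
Proof.
move=> [p1 p2] [q1 q2] pq; congr pair.
  apply: mhausdorff => U V nU nV.
  have [] := pq (fst @^-1` U) (fst @^-1` V).
  - exact: cvg_fst.
  - exact: cvg_fst.
  - by move=> z [? ?]; exists z.1.
apply: mhausdorff => U V nU nV.
have [] := pq (snd @^-1` U) (snd @^-1` V).
- exact: cvg_snd.
- exact: cvg_snd.
- by move=> z [? ?]; exists z.2.
Qed.

Lemma openX (T1 T2 : topologicalType) (U : set T1) (V : set T2) :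
  open U -> open V -> open (U `*` V).
Proof.
move=> oU oV; rewrite openE => -[x y] [/= Ux Vy].
by exists (U, V) => //; split; exact: open_nbhs_nbhs.
Qed.

Lemma prod_second_countable : @second_countable PT.
Proof.
have [b1 cb1 [ob1 bb1]] := msecond_countable B.
have [b2 cb2 [ob2 bb2]] := msecond_countable F.
exists ((fun UV : set B * set F => UV.1 `*` UV.2) @` (b1 `*` b2)).
  exact: sub_countable (card_image_le _ _) (countableX cb1 cb2).
split=> [_ [[U V] [/= bU bV] <-]|[x y] W [[U V] /= [nU nV] UVW]].
  by apply: openX; [exact: ob1|exact: ob2].
have [U' [bU' U'x] U'U] := bb1 x U nU.
have [V' [bV' V'y] V'V] := bb2 y V nV.
exists (U' `*` V'); first by split=> //; exists (U', V').
by move=> z [/= /U'U ? /V'V ?]; exact: UVW.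
Qed.

Lemma prod_img (c : PT) : prod_chart c @` prod_dom c =
  (lsubmx @^-1` chart_img c.1) `&` (rsubmx @^-1` chart_img c.2).
Proof.
apply/seteqP; split=> [_ [z [z1 z2] <-]|x [[p cp px] [q cq qx]]].
  by rewrite /prod_chart; split=> /=; rewrite ?row_mxKl ?row_mxKr;
    [exists z.1|exists z.2].
by exists (p, q) => //; rewrite /prod_chart /= px qx hsubmxK.
Qed.

Lemma prod_dom_open c : open (prod_dom c).
Proof. by apply: openX; exact: chart_dom_open. Qed.

Lemma prod_dom_center c : prod_dom c c.
Proof. by split; exact: chart_dom_center. Qed.

Lemma open_lsub (m n : nat) (U : set 'rV[R]_m) :
  open U -> open ((@lsubmx R 1 m n) @^-1` U).
Proof. by apply: open_comp => x _; exact: continuous_lsubmx. Qed.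

Lemma open_rsub (m n : nat) (U : set 'rV[R]_n) :
  open U -> open ((@rsubmx R 1 m n) @^-1` U).
Proof. by apply: open_comp => x _; exact: continuous_rsubmx. Qed.

Lemma prod_img_open c : open (prod_chart c @` prod_dom c).
Proof.
rewrite prod_img; apply: openI; [apply: open_lsub|apply: open_rsub];
  exact: chart_img_open.
Qed.

Lemma prod_chartK c : {in prod_dom c, cancel (prod_chart c) (prod_param c)}.
Proof.
move=> z; rewrite inE => -[z1 z2].
rewrite /prod_param /prod_chart row_mxKl row_mxKr !chartK ?inE//.
by case: z {z1 z2}.
Qed.

Lemma prod_chart_continuous (c z : PT) : prod_dom c z ->
  {for z, continuous (prod_chart c)}.
Proof.
move=> [z1 z2]; apply/cvg_ballP => e e0.
have /cvg_ballP/(_ e e0) H1 := chart_continuous z1.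
have /cvg_ballP/(_ e e0) H2 := chart_continuous z2.
exists ([set p | ball (chart c.1 z.1) e (chart c.1 p)],
        [set q | ball (chart c.2 z.2) e (chart c.2 q)]); first by split.
move=> [p q] [/= [_ H3] [_ H4]]; split=> // i j.
by rewrite /prod_chart !mxE /=; case: fintype.split => k; [exact: H3|exact: H4].
Qed.

Lemma prod_param_continuous c x : (prod_chart c @` prod_dom c) x ->
  {for x, continuous (prod_param c)}.
Proof.
rewrite prod_img => -[x1 x2].
move=> P [[U V] /= [nU nV] UVP].
have nl : nbhs x (fun y => U (param c.1 (lsubmx y))).
  exact: (@continuous_lsubmx R 1 (mdim B) (mdim F) x) _ (param_continuous x1 nU).
have nr : nbhs x (fun y => V (param c.2 (rsubmx y))).
  exact: (@continuous_rsubmx R 1 (mdim B) (mdim F) x) _ (param_continuous x2 nV).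
by apply: filterS2 nl nr => y Uy Vy; exact: UVP.
Qed.

Lemma prod_transition c d j :
  Cinf (prod_chart c @` (prod_dom c `&` prod_dom d))
       (fun x => prod_chart d (prod_param c x) 0 j).
Proof.
move=> k; case: (split_ordP j) => i ->.
  rewrite (_ : (fun x => _) =
    (fun x => chart d.1 (param c.1 x) 0 i) \o (@lsubmx R 1 _ (mdim F))).
    apply: Ck_sub (Ck_lsubmx (mdim F) (chart_transition c.1 d.1 i k)).
    move=> _ [z [[c1 c2] [d1 d2]] <-] /=.
    by rewrite /prod_chart row_mxKl; exists z.1.
  by apply/funext => x /=; rewrite /prod_chart row_mxEl.
rewrite (_ : (fun x => _) =
  (fun x => chart d.2 (param c.2 x) 0 i) \o (@rsubmx R 1 (mdim B) _)).
  apply: Ck_sub (Ck_rsubmx (mdim B) (chart_transition c.2 d.2 i k)).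
  move=> _ [z [[c1 c2] [d1 d2]] <-] /=.
  by rewrite /prod_chart row_mxKr; exists z.2.
by apply/funext => x /=; rewrite /prod_chart row_mxEr.
Qed.

Definition prod_manifold : manifold R :=
  @Manifold R PT (mdim B + mdim F) prod_dom prod_chart prod_param
    prod_hausdorff prod_second_countable prod_dom_open prod_dom_center
    prod_img_open prod_chartK prod_chart_continuous prod_param_continuous
    prod_transition.

Definition projB : prod_manifold -> B := fst.
Definition projF : prod_manifold -> F := snd.

End Product.

Section Tangent.
Context {R : realType}.

Lemma vderiv_linear (M : manifold R) (p : M) (h : M -> R) :
  scalar (fun v => vderiv p v h).
Proof.
move=> a v w; rewrite /vderiv mulr_sumr -big_split/=.
by apply: eq_bigr => i _; rewrite !mxE mulrDl mulrA.
Qed.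

Lemma differential_linear (M N : manifold R) (phi : M -> N) (p : M) :
  linear (differential phi p).
Proof.
by move=> a v w; apply/rowP => j; rewrite !mxE vderiv_linear.
Qed.

Lemma derive_coord n (j : 'I_n) (x d : 'rV[R]_n) :
  'D_d (fun y : 'rV[R]_n => y 0 j : R) x = d 0 j.
Proof.
have dl := @differentiable_coord R 1 n x 0 j.
rewrite (deriveE d dl).
have @f : {linear 'rV[R]_n -> R}.
  by exists (fun N : 'rV[R]_n => N 0 j); do 2![eexists]; do ?[constructor];
     rewrite ?mxE// => ? *; rewrite ?mxE//; move=> ?; rewrite !mxE.
rewrite (_ : (fun _ => _) = f)// diff_lin//.
exact: (@coord_continuous R 1 n 0 j).
Qed.

Lemma derive_chart (M : manifold R) (p : M) (j : 'I_(mdim M))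
    (d : 'rV[R]_(mdim M)) :
  'D_d (coord p j \o param p) (chart p p) = d 0 j.
Proof.
rewrite -[RHS](derive_coord j (chart p p)); apply: near_eq_derive.
have : chart_img p (chart p p) by exists p => //; exact: chart_dom_center.
move=> px; have := open_nbhs_nbhs (conj (chart_img_open (c := p)) px).
apply: filterS => _ [q pq <-] /=.
by rewrite /coord chartK ?inE.
Qed.

End Tangent.

Section Warped.
Context {R : realType}.

Section Projections.
Variables B F : manifold R.

Lemma differential_projB (z : prod_manifold B F) v :
  differential (@projB R B F) z v = lsubmx v.
Proof.
apply/rowP => j; rewrite !mxE /vderiv.
under eq_bigr => i _.
  rewrite (_ : partial _ _ _ = lsubmx (delta_mx 0 i : 'rV[R]_(mdim B + mdim F)) 0 j).
    over.
  rewrite /partial -(@derive_chart R _ z.1).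
  rewrite -[chart z.1 z.1](row_mxKl _ (chart z.2 z.2)).
  exact: (derive_comp_linear (@lsubmx R 1 (mdim B) (mdim F))).
rewrite {2}(row_sum_delta v) summxE; apply: eq_bigr => i _.
by rewrite !mxE.
Qed.

Lemma differential_projF (z : prod_manifold B F) v :
  differential (@projF R B F) z v = rsubmx v.
Proof.
apply/rowP => j; rewrite !mxE /vderiv.
under eq_bigr => i _.
  rewrite (_ : partial _ _ _ = rsubmx (delta_mx 0 i : 'rV[R]_(mdim B + mdim F)) 0 j).
    over.
  rewrite /partial -(@derive_chart R _ z.2).
  rewrite -[chart z.2 z.2](row_mxKr (chart z.1 z.1)).
  exact: (derive_comp_linear (@rsubmx R 1 (mdim B) (mdim F))).
rewrite {2}(row_sum_delta v) summxE; apply: eq_bigr => i _.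
by rewrite !mxE.
Qed.

Lemma lsubmx_frame (c z : prod_manifold B F) i :
  lsubmx (frame c i z) =
  match fintype.split i with inl k => frame c.1 k z.1 | inr _ => 0 end.
Proof.
apply/rowP => j; rewrite !mxE.
have -> : coord z (lshift (mdim F) j) \o param c =
    (coord z.1 j \o param c.1) \o @lsubmx R 1 (mdim B) (mdim F).
  by apply/funext => x; rewrite /coord /= /prod_chart row_mxEl.
rewrite /partial derive_comp_linear /= lsubmx_delta row_mxKl.
by case: fintype.split => k; rewrite ?derive0 mxE.
Qed.

Lemma rsubmx_frame (c z : prod_manifold B F) i :
  rsubmx (frame c i z) =
  match fintype.split i with inl _ => 0 | inr k => frame c.2 k z.2 end.
Proof.
apply/rowP => j; rewrite !mxE.
have -> : coord z (rshift (mdim B) j) \o param c =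
    (coord z.2 j \o param c.2) \o @rsubmx R 1 (mdim B) (mdim F).
  by apply/funext => x; rewrite /coord /= /prod_chart row_mxEr.
rewrite /partial derive_comp_linear /= rsubmx_delta row_mxKr.
by case: fintype.split => k; rewrite ?derive0 mxE.
Qed.

End Projections.

Variables (B F : srmanifold R) (f : B -> R).
Local Notation P := (prod_manifold B F).

Definition warped_metric (z : P) (v w : 'rV[R]_(mdim P)) : R :=
  metric (projB z) (differential (@projB R B F) z v)
                   (differential (@projB R B F) z w) +
  f (projB z) ^+ 2 *
  metric (projF z) (differential (@projF R B F) z v)
                   (differential (@projF R B F) z w).

Lemma warped_metric_sym z v w : warped_metric z v w = warped_metric z w v.
Proof. by rewrite /warped_metric metric_sym [in X in _ + X]metric_sym. Qed.

Lemma warped_metric_linear z v : scalar (warped_metric z v).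
Proof.
move=> a u w; rewrite /warped_metric !differential_linear !metric_linear.
by rewrite mulrDr addrACA mulrDr mulrCA.
Qed.

Lemma metric0r (M : srmanifold R) (p : M) v : metric p v 0 = 0.
Proof.
have := metric_linear p v 1 0 0; rewrite scaler0 addr0 mul1r => /eqP.
by rewrite -subr_eq0 opprD addNKr oppr_eq0 => /eqP.
Qed.

Lemma metric0l (M : srmanifold R) (p : M) v : metric p 0 v = 0.
Proof. by rewrite metric_sym metric0r. Qed.

Hypothesis f_smooth : smooth_fun f.

Lemma warped_metric_smooth c i j : Cinf (chart_img c)
  ((fun z => warped_metric z (frame c i z) (frame c j z)) \o param c).
Proof.
move=> k.
have oU : open (chart_img c) by exact: chart_img_open.
have CB (u : 'rV[R]_(mdim B) -> R) : Ck k (chart_img c.1) u ->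
    Ck k (chart_img c) (u \o @lsubmx R 1 _ (mdim F)).
  move=> Cu; apply: Ck_sub (Ck_lsubmx (mdim F) Cu).
  by rewrite /chart_img /= prod_img => x [].
have CF (u : 'rV[R]_(mdim F) -> R) : Ck k (chart_img c.2) u ->
    Ck k (chart_img c) (u \o @rsubmx R 1 (mdim B) _).
  move=> Cu; apply: Ck_sub (Ck_rsubmx (mdim B) Cu).
  by rewrite /chart_img /= prod_img => x [].
have Cf := CB _ (f_smooth c.1 k).
rewrite (_ : _ \o _ = fun x =>
   metric (param c.1 (lsubmx x)) (lsubmx (frame c i (param c x)))
                                 (lsubmx (frame c j (param c x))) +
   (f (param c.1 (lsubmx x)) * f (param c.1 (lsubmx x))) *
   metric (param c.2 (rsubmx x)) (rsubmx (frame c i (param c x)))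
                                 (rsubmx (frame c j (param c x)))); last first.
  apply/funext => x.
  by rewrite /= /warped_metric !differential_projB !differential_projF expr2.
apply: Ck_add => //; last apply: Ck_mul => //; first last.
- rewrite (_ : (fun x => _) = fun x : 'rV[R]_(mdim B + mdim F) =>
    match fintype.split i, fintype.split j with
    | inr i', inr j' =>
        ((fun q => metric q (frame c.2 i' q) (frame c.2 j' q)) \o param c.2)
          (rsubmx x)
    | _, _ => 0 end); last first.
    apply/funext => x; rewrite !rsubmx_frame.
    by case: (fintype.split i) => i'; case: (fintype.split j) => j';
      rewrite ?metric0l ?metric0r.
  case: (fintype.split i) => i'; case: (fintype.split j) => j'; try exact: Ck_cst.
  by apply: CF; exact: metric_smooth.
- exact: Ck_mul.
rewrite (_ : (fun x => _) = fun x : 'rV[R]_(mdim B + mdim F) =>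
    match fintype.split i, fintype.split j with
    | inl i', inl j' =>
        ((fun q => metric q (frame c.1 i' q) (frame c.1 j' q)) \o param c.1)
          (lsubmx x)
    | _, _ => 0 end); last first.
  apply/funext => x; rewrite !lsubmx_frame.
  by case: (fintype.split i) => i'; case: (fintype.split j) => j';
    rewrite ?metric0l ?metric0r.
case: (fintype.split i) => i'; case: (fintype.split j) => j'; try exact: Ck_cst.
by apply: CB; exact: metric_smooth.
Qed.

Definition warped_product : srmanifold R :=
  SRManifold warped_metric_sym warped_metric_linear warped_metric_smooth.

End Warped.

Section Lifts.
Context {R : realType} (B F : manifold R).
Local Notation P := (prod_manifold B F).

Definition inclB (q : F) : B -> P := fun p => (p, q).
Definition inclF (p : B) : F -> P := fun q => (p, q).

(* A vector tangent to B x {q} is one in the image of the differential of the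
   inclusion of B x {q}. *)
Definition is_lift_B (X : vfield P) (XB : vfield B) : Prop :=
  [/\ smooth_vf XB, smooth_vf X & forall p q,
    differential (@projB R B F) (p, q) (X (p, q)) = XB p /\
    exists v, X (p, q) = differential (inclB q) p v].

Definition is_lift_F (V : vfield P) (VF : vfield F) : Prop :=
  [/\ smooth_vf VF, smooth_vf V & forall p q,
    differential (@projF R B F) (p, q) (V (p, q)) = VF q /\
    exists v, V (p, q) = differential (inclF p) q v].

Definition is_lift (A : vfield P) : Prop :=
  (exists XB, is_lift_B A XB) \/ (exists VF, is_lift_F A VF).

End Lifts.

(* Main.v *)
Require Import Defs.
From mathcomp Require Import all_boot all_order all_algebra.
From mathcomp Require Import ring lra.
From mathcomp Require Import all_classical all_reals all_analysis.

Set Implicit Arguments.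
Unset Strict Implicit.
Unset Printing Implicit Defensive.

Import Order.TTheory GRing.Theory Num.Theory.
Import numFieldNormedType.Exports.

Local Open Scope classical_set_scope.
Local Open Scope ring_scope.

(* On a product, the derivative of a function in the direction of an arbitrary
   vector splits, without any regularity, into the derivatives of its two
   slices.  Hence for lifts X, Y from B and V, W from F and every smooth field
   Z on B x F, with slices Z_q = lsubmx Z(., q) and Z^p = rsubmx Z(p, .),
     K(X, Y, Z) = K_B(X, Y, Z_q),
     K(X, V, Z) = K(V, X, Z) = f X(f) <V, Z^p>_F,
     K(V, W, Z) = - f Z_q(f) <V, W>_F + f^2 K_F(V, W, Z^p).
   So the covectors K(., ., _) are represented at (p, q) by the vectors
   (v, 0), (0, (X(f)/f) V) and (- f <V, W>_F grad f, w), where v, grad f and w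
   represent the corresponding covectors of B and F; this gives the products
   <<., .>> entering the curvature and then the curvature itself.  That the
   value of bullet_ip does not depend on the representatives requires every
   tangent vector to extend to a smooth vector field, i.e. bump functions.
   The symmetries hold on any manifold for vector fields with representable
   covariant derivatives: the pair symmetry follows from the first Bianchi
   identity, itself a consequence of the Jacobi identity. *)

(* These three names are shadowed by MathComp's. *)
Local Notation coord := Defs.coord.
Local Notation deriv := Defs.deriv.
Local Notation metric_sym := Defs.metric_sym.

(** * Calculus in coordinates *)

(** A covector on the product is tested against every smooth field Z, not only against lifts. The
    components of Z depend on both factors, so the Koszul formula contains derivatives of its F-part
    along B and of its B-part along F. The mixed case rests on their cancellation: between X<V, Z>
    and <V, [Z, X]> for the former, between V<Z, X> and <X, [V, Z]> for the latter. The other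
    obstacle is the zero set of f. There f^2 g_F vanishes, the coefficient X(f)/f is read as 0, and
    the product of two mixed covectors is 0 instead of X(f) Y(f) <V, W>_F, its value wherever f <>
    0. In R(X, Y, W, Q) such products occur twice with opposite signs; in R(X, V, W, T) one occurs
    alone, whence the condition f <> 0 or df = 0. Bracket identities need symmetric second
    derivatives, which [Ck] does not assert; hence the detour through Schwarz's theorem. *)

Section PartialDerivatives.
Context {R : realType}.

Lemma continuous_row (T : topologicalType) n (phi : T -> 'rV[R]_n) x :
  (forall j, {for x, continuous (fun y => phi y 0 j : R)}) ->
  {for x, continuous phi}.
Proof.
move=> cphi; apply/cvg_ballP => e e0.
have : \forall t \near x, forall j, ball (phi x 0 j) e (phi t 0 j).
  by apply: filter_forall => j; have /cvg_ballP := cphi j; exact.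
by apply: filterS => t H; split=> // i j; rewrite (ord1 i).
Qed.

Lemma differentiable_row m n (phi : 'rV[R]_m -> 'rV[R]_n) x :
  (forall j, differentiable (fun y => phi y 0 j : R) x) -> differentiable phi x.
Proof.
move=> dphi.
rewrite (_ : phi = \sum_(j < n) (fun y => phi y 0 j *: (delta_mx 0 j : 'rV[R]_n))).
  by apply: differentiable_sum => j; exact: differentiableZl.
by apply/funext => y; rewrite fct_sumE {1}(row_sum_delta (phi y)).
Qed.

Lemma partial_comp m n (phi : 'rV[R]_m -> 'rV[R]_n) (u : 'rV[R]_n -> R) x i :
  differentiable phi x -> differentiable u (phi x) ->
  partial i (u \o phi) x =
  \sum_j partial j u (phi x) * partial i (fun y => phi y 0 j) x.
Proof.
move=> dphi du.
rewrite /partial deriveE; last exact: differentiable_comp.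
rewrite diff_comp//= [X in 'd u (phi x) X]row_sum_delta linear_sum.
apply: eq_bigr => j _; rewrite linearZ /= -deriveE// mulrC; congr (_ * _).
  by rewrite derive_mx ?mxE//; exact: diff_derivable.
by rewrite deriveE.
Qed.

Lemma partialD n (u v : 'rV[R]_n -> R) x i :
  differentiable u x -> differentiable v x ->
  partial i (fun y => u y + v y) x = partial i u x + partial i v x.
Proof. by move=> du dv; apply: deriveD; exact: diff_derivable. Qed.

Lemma partialM n (u v : 'rV[R]_n -> R) x i :
  differentiable u x -> differentiable v x ->
  partial i (fun y => u y * v y) x = u x * partial i v x + v x * partial i u x.
Proof. by move=> du dv; apply: deriveM; exact: diff_derivable. Qed.

Lemma partial_sum m n (u : 'I_m -> 'rV[R]_n -> R) x i :
  (forall j, differentiable (u j) x) ->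
  partial i (fun y => \sum_j u j y) x = \sum_j partial i (u j) x.
Proof.
move=> du; rewrite /partial -derive_sum => [|j]; last exact: diff_derivable.
by rewrite fct_sumE.
Qed.

Lemma partial_cst n (a : R) (x : 'rV[R]_n) i : partial i (fun=> a) x = 0.
Proof. exact: derive_cst. Qed.

Lemma partial_coord n (x : 'rV[R]_n) i j :
  partial i (fun y : 'rV[R]_n => y 0 j) x = (j == i)%:R.
Proof. by rewrite /partial derive_coord mxE eqxx. Qed.

Lemma Ck_coord k n (U : set 'rV[R]_n) j : Ck k U (fun x : 'rV[R]_n => x 0 j).
Proof.
case: k => [|k] /=.
  by move=> x _; apply: differentiable_continuous; exact: differentiable_coord.
split=> [x _|i]; first exact: differentiable_coord.
rewrite (_ : partial _ _ = cst (j == i)%:R); first exact: Ck_cst.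
by apply/funext => x; exact: partial_coord.
Qed.

Lemma Ck_sum k m n (U : set 'rV[R]_n) (u : 'I_m -> 'rV[R]_n -> R) :
  open U -> (forall j, Ck k U (u j)) -> Ck k U (fun x => \sum_j u j x).
Proof.
move=> oU; elim: m u => [|m IHm] u Cu.
  rewrite (_ : (fun _ => _) = cst 0); first exact: Ck_cst.
  by apply/funext => x; rewrite big_ord0.
rewrite (_ : (fun _ => _) = fun x => u ord0 x + \sum_(j < m) u (lift ord0 j) x).
  exact: Ck_add (IHm _ _).
by apply/funext => x; rewrite big_ord_recl.
Qed.

(** Each clause of [Ck] is a condition point by point, so a different formula may be used near each
    point; the cut-off field of [vf_extension] is treated this way. *)
Lemma Ck_local k n (U : set 'rV[R]_n) (u : 'rV[R]_n -> R) :
  (forall x, U x -> exists2 V, open_nbhs x V & Ck k V u) -> Ck k U u.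
Proof.
elim: k u => [|k IHk] u UV /=.
  by move=> x /UV [V [_ Vx]]; exact.
split=> [x /UV [V [_ Vx]] [+ _]|j]; first exact.
by apply: IHk => x /UV [V Vx [_ pu]]; exists V => //; exact: pu.
Qed.

Lemma Cinf_differentiable n (U : set 'rV[R]_n) (u : 'rV[R]_n -> R) x :
  Cinf U u -> U x -> differentiable u x.
Proof. by move=> /(_ 1) [+ _]; exact. Qed.

Lemma Cinf_partial n (U : set 'rV[R]_n) (u : 'rV[R]_n -> R) j :
  Cinf U u -> Cinf U (partial j u).
Proof. by move=> Cu k; have [_] := Cu k.+1; exact. Qed.

(** The chain rule turns a partial derivative of [u \o phi] into a sum of products of a composite of
    lower order with a partial derivative of [phi]; hence the induction on k with [u] varying. *)
Lemma Ck_comp k m n (U : set 'rV[R]_m) (V : set 'rV[R]_n)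
    (phi : 'rV[R]_m -> 'rV[R]_n) (u : 'rV[R]_n -> R) :
  open U -> U `<=` phi @^-1` V ->
  (forall j, Ck k U (fun x => phi x 0 j)) -> Ck k V u -> Ck k U (u \o phi).
Proof.
move=> oU UV; elim: k u => [|k IHk] u /=.
  move=> cphi cu x Ux.
  have cphix : {for x, continuous phi} by apply: continuous_row => j; exact: cphi.
  exact: (continuous_comp cphix (cu _ (UV _ Ux))).
move=> Cphi [du pu].
have dphi x : U x -> differentiable phi x.
  by move=> Ux; apply: differentiable_row => j; have [+ _] := Cphi j; exact.
split=> [x Ux|i].
  by apply: differentiable_comp; [exact: dphi|exact/du/UV].
apply: (@Ck_ext _ _ _ _
  (fun x => \sum_j (partial j u \o phi) x * partial i (fun y => phi y 0 j) x)) => //.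
  by move=> x; rewrite inE => Ux; rewrite partial_comp; [|exact: dphi|exact/du/UV].
apply: Ck_sum => // j; apply: Ck_mul => //.
  by apply: IHk => // l; exact: CkS (Cphi l).
by have [_] := Cphi j; exact.
Qed.

End PartialDerivatives.

(** * Equality of mixed partial derivatives *)

Section Schwarz.
Context {R : realType} (n : nat).
Implicit Types (u w : 'rV[R]_n -> R) (x v : 'rV[R]_n).

Lemma MVT_direction w x v (h : R) : 0 < h ->
  (forall a, 0 <= a <= h -> differentiable w (a *: v + x)) ->
  exists2 a, 0 < a < h & w (h *: v + x) - w x = 'D_v w (a *: v + x) * h.
Proof.
move=> h0 dw; pose g (a : R) := w (a *: v + x).
have dg a : 0 <= a <= h -> is_derive a 1 g ('D_v w (a *: v + x)).
  move=> ah; have dwa := diff_derivable (v := v) (dw a ah).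
  (* Both difference quotients are the same function of t, so the derivative of [g] needs no chain
     rule. *)
  have E : (fun t : R => t^-1 *: ((w \o shift (a *: v + x)) (t *: v) - w (a *: v + x)))
         = (fun t : R => t^-1 *: ((g \o shift a) (t *: 1) - g a)).
    apply/funext => t; rewrite /g /=; congr (_ *: (w _ - _)).
    by rewrite addrA -scalerDl; congr ((_ + _) *: _ + _); exact/esym/mulr1.
  have dga : derivable g a 1 by rewrite /derivable -E.
  by apply: DeriveDef => //; rewrite /derive -E.
have gc : {within `[0, h], continuous g}.
  apply: derivable_within_continuous => a; rewrite in_itv /= => ah.
  by have [] := dg a ah.
have [a] := MVT h0 (fun a ah => dg a (subset_itv_oo_cc ah)) gc.
rewrite in_itv /= subr0 /g scale0r add0r => ah E.
by exists a.
Qed.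

Lemma derive_translate w x v (d : 'rV[R]_n) :
  'D_v (fun y => w (d + y)) x = 'D_v w (d + x).
Proof.
rewrite /derive; set F := fun t : R => _; set G := fun t : R => _.
by have -> : F = G by apply/funext => t; rewrite /F /G /= addrCA.
Qed.

Lemma plane_near x v v' (W : set 'rV[R]_n) : nbhs x W ->
  exists2 r : R, 0 < r & forall a b, 0 <= a <= r -> 0 <= b <= r ->
    W (a *: v + (b *: v' + x)).
Proof.
move=> nW.
have : (fun z : R * R => z.1 *: v + (z.2 *: v' + x)) @ (0 : R, 0 : R) -->
    0 *: v + (0 *: v' + x).
  apply: cvgD; first by apply: cvgZr_tmp; exact: cvg_fst.
  apply: cvgD; last exact: cvg_cst.
  by apply: cvgZr_tmp; exact: cvg_snd.
rewrite !scale0r !add0r.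
move=> /(_ W nW) [[P Q] /= [/nbhs_ballP [r r0 rP] /nbhs_ballP [s s0 sQ]] PQ].
(* Halving turns the closed bounds on a and b into the strict ones that the open balls require. *)
exists (Num.min r s / 2) => [|a b /andP[a0 ar] /andP[b0 bs]].
  by rewrite divr_gt0// lt_min r0 s0.
have h : Num.min r s / 2 < Num.min r s.
  by rewrite ltr_pdivrMr// ltr_pMr ?ltr1n// lt_min r0 s0.
apply: (PQ (a, b)); split => /=.
  apply: rP; rewrite /ball /= sub0r normrN ger0_norm//.
  by apply: le_lt_trans ar (lt_le_trans h _); rewrite ge_min lexx.
apply: sQ; rewrite /ball /= sub0r normrN ger0_norm//.
by apply: le_lt_trans bs (lt_le_trans h _); rewrite ge_min lexx orbT.
Qed.

(* The second difference of u along the two coordinate axes is symmetric in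
   the axes, and two applications of the mean value theorem turn it into h^2
   times a mixed partial derivative at a nearby point. *)
Lemma second_difference u x i j (h : R) (U : set 'rV[R]_n) : 0 < h ->
  (forall a b, 0 <= a <= h -> 0 <= b <= h ->
     U (a *: delta_mx 0 i + (b *: delta_mx 0 j + x))) -> Ck 2 U u ->
  exists a b : R, [/\ 0 <= a <= h, 0 <= b <= h &
    u (h *: delta_mx 0 i + (h *: delta_mx 0 j + x)) - u (h *: delta_mx 0 i + x)
    - u (h *: delta_mx 0 j + x) + u x =
    partial j (partial i u) (a *: delta_mx 0 i + (b *: delta_mx 0 j + x)) * h ^+ 2].
Proof.
move=> h0 hU [du d2u].
have hh : 0 <= h <= h by rewrite lexx ltW.
have zh : 0 <= (0 : R) <= h by rewrite lexx ltW.
(* [g] is the first difference along axis j, and its increment along axis i is the second difference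
   of u. The mean value theorem is applied to [g] along axis i, then to [partial i u] along axis
   j. *)
pose g := fun y => u (h *: delta_mx 0 j + y) - u y.
have sh (d y : 'rV[R]_n) : differentiable (fun z : 'rV[R]_n => d + z) y.
  by apply: differentiableD => //; exact: differentiable_cst.
have dg a : 0 <= a <= h -> differentiable g (a *: delta_mx 0 i + x).
  move=> ah; apply: differentiableB.
    apply: (@differentiable_comp _ _ _ _ (fun y => h *: delta_mx 0 j + y)) => //.
    by apply: du; rewrite /= addrCA; exact: hU.
  by apply: du; have := hU a 0 ah zh; rewrite scale0r add0r.
have [a ah gE] := MVT_direction h0 dg.
have ah' : 0 <= a <= h by case/andP: ah => /ltW -> /ltW ->.
have gD : 'D_(delta_mx 0 i) g (a *: delta_mx 0 i + x) =
    partial i u (h *: delta_mx 0 j + (a *: delta_mx 0 i + x)) -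
    partial i u (a *: delta_mx 0 i + x).
  have d1 : differentiable u (h *: delta_mx 0 j + (a *: delta_mx 0 i + x)).
    by apply: du; rewrite addrCA; exact: hU.
  have d2 : differentiable u (a *: delta_mx 0 i + x).
    by apply: du; have := hU a 0 ah' zh; rewrite scale0r add0r.
  rewrite deriveB; last 2 first.
  - apply: diff_derivable.
    exact: (@differentiable_comp _ _ _ _ (fun y => h *: delta_mx 0 j + y)).
  - exact: diff_derivable.
  by rewrite derive_translate.
have [d1u _] := d2u i.
have db b : 0 <= b <= h ->
    differentiable (partial i u) (b *: delta_mx 0 j + (a *: delta_mx 0 i + x)).
  by move=> bh; apply: d1u; rewrite addrCA; exact: hU.
have [b bh bE] := MVT_direction h0 db.
have bh' : 0 <= b <= h by case/andP: bh => /ltW -> /ltW ->.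
exists a, b; split => //.
rewrite (addrCA (h *: delta_mx 0 i)) (addrCA (a *: delta_mx 0 i)) expr2 mulrA.
have {}bE : _ = partial j (partial i u) _ * h := bE.
by rewrite -bE -gD -gE /g opprB [u x - _]addrC !addrA.
Qed.

(** One second difference, expanded with the axes in either order, is r^2 times one or the other
    mixed derivative at points near x. Both are continuous at x, so their values there differ by at
    most e, for every e > 0. *)
Lemma partialC u x i j (U : set 'rV[R]_n) : open U -> U x -> Ck 2 U u ->
  partial i (partial j u) x = partial j (partial i u) x.
Proof.
move=> oU Ux Cu; apply/eqP; rewrite -subr_eq0 -normr_le0; apply/ler_addgt0Pl => e e0.
have e2 : 0 < e / 2 by rewrite divr_gt0.
have cont l m : \forall y \near x,
    `|partial l (partial m u) x - partial l (partial m u) y| < e / 2.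
  have [_ /(_ m) [_ /(_ l) /(_ x Ux)]] := Cu.
  by move/cvgrPdist_lt => /(_ _ e2).
have nU : nbhs x U by exact: open_nbhs_nbhs.
have [r r0 rW] := plane_near (delta_mx 0 i) (delta_mx 0 j)
  (filterI nU (filterI (cont i j) (cont j i))).
have rW' a b : 0 <= a <= r -> 0 <= b <= r -> 
    (U `&` ([set y | `|partial i (partial j u) x - partial i (partial j u) y| < e / 2]
     `&` [set y | `|partial j (partial i u) x - partial j (partial i u) y| < e / 2]))
     (a *: delta_mx 0 j + (b *: delta_mx 0 i + x)).
  by move=> ar br; rewrite addrCA; exact: rW.
have [a [b [ar br E1]]] := second_difference r0 (fun a b ar br => (rW a b ar br).1) Cu.
have [c [d [cr dr E2]]] := second_difference r0 (fun a b ar br => (rW' a b ar br).1) Cu.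
have E : partial j (partial i u) (a *: delta_mx 0 i + (b *: delta_mx 0 j + x)) =
         partial i (partial j u) (c *: delta_mx 0 j + (d *: delta_mx 0 i + x)).
  apply: (mulIf (x := r ^+ 2)); first by rewrite expf_neq0// gt_eqF.
  apply: etrans (esym E1) (etrans _ E2).
  rewrite (addrCA (r *: delta_mx 0 j) (r *: delta_mx 0 i)).
  by rewrite [u _ - _ - _]addrAC.
have [_ [_ /= H1]] := rW _ _ ar br.
have [_ [/= H2 _]] := rW' _ _ cr dr.
rewrite addr0; move: H1 H2 E.
move: (partial j _ _) (partial i _ _) (partial j _ x) (partial i _ x) => c1 c2 A1 A2 H1 H2 E.
rewrite (splitr e) -(subrKA c2); apply: le_trans (ler_normD _ _) _.
by apply: lerD; [exact: ltW|rewrite -E distrC; exact: ltW].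
Qed.

End Schwarz.

(** * Smooth bump functions *)

Section Bump.
Context {R : realType}.

(* The family is closed under differentiation:
   d/dt (exp_inv m) = - m exp_inv (m+1) + exp_inv (m+2). *)
Definition exp_inv (m : nat) (t : R) : R :=
  if 0 < t then t^-1 ^+ m * expR (- t^-1) else 0.

(** A single term of the exponential series, s^(m+1) / (m+1)! <= e^s at s = 1/t, yields the constant
    (m+1)!. Linear decay at 0 is what the derivative at 0 requires. *)
Lemma exp_inv_bound m : exists2 C : R, 0 < C & forall t, `|exp_inv m t| <= C * `|t|.
Proof.
exists (m.+1`!%:R); first by rewrite ltr0n fact_gt0.
move=> t; rewrite /exp_inv; case: ifPn => [t0|_]; last first.
  by rewrite normr0 mulr_ge0// ler0n.
have s0 : 0 < t^-1 by rewrite invr_gt0.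
rewrite gtr0_norm; last by rewrite mulr_gt0 ?exprn_gt0 ?expR_gt0.
rewrite gtr0_norm// expRN ler_pdivrMr ?expR_gt0//.
have F0 : 0 < m.+1`!%:R :> R by rewrite ltr0n fact_gt0.
have H : t^-1 ^+ m.+1 <= m.+1`!%:R * expR t^-1.
  rewrite mulrC -ler_pdivrMr//.
  by apply: le_trans (expR_ge1Dxn m (ltW s0)); rewrite lerDr.
have := ler_wpM2l (ltW t0) H.
by rewrite exprS mulrA divff ?gt_eqF// mul1r => /le_trans; apply; rewrite mulrCA mulrA.
Qed.

Lemma exp_inv_derive m (t : R) :
  is_derive t 1 (exp_inv m) (- m%:R * exp_inv m.+1 t + exp_inv m.+2 t).
Proof.
have [t0|t0|->] := ltgtP t 0.
- have E : \forall s \near t, cst 0 s = exp_inv m s.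
    near=> s; rewrite /exp_inv ifF//; apply/negbTE; rewrite -leNgt ltW//.
    by near: s; exact: lt_nbhsl.
  apply: (near_eq_is_derive E); rewrite /exp_inv !ifF ?mulr0 ?addr0; last 2 first.
  + by apply/negbTE; rewrite -leNgt ltW.
  + by apply/negbTE; rewrite -leNgt ltW.
  exact: is_derive_cst.
- have E : \forall s \near t, s^-1 ^+ m * expR (- s^-1) = exp_inv m s.
    near=> s; rewrite /exp_inv ifT//.
    by near: s; exact: lt_nbhsr.
  apply: (near_eq_is_derive E); rewrite /exp_inv t0.
  have tN0 : t != 0 by rewrite gt_eqF.
  have dV : is_derive t 1 (fun s : R => s^-1) (- t ^- 2 *: 1).
    by apply: is_deriveV.
  have dE : is_derive t 1 (fun s : R => expR (- s^-1)) (t ^- 2 * expR (- t^-1)).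
    have dN := is_deriveN dV.
    have H : is_derive t 1 (fun s : R => expR (- s^-1)) _ :=
      @is_derive1_comp R expR (- (fun s : R => s^-1)) t _ _ (is_derive_expR _) dN.
    apply: is_derive_eq H _.
    by rewrite scaleNr opprK mulrC; congr (_ * _); exact: mulr1.
  have dX := is_deriveX m dV.
  rewrite (_ : (fun s => _) = (fun s : R => s^-1) ^+ m * (fun s => expR (- s^-1))); last first.
    by apply/funext => s; rewrite !fctE.
  apply: is_derive_eq (is_deriveM dX dE) _; rewrite fctE.
  rewrite -!exprVn; set s := t^-1; set e := expR _.
  have sE (a b : R) : a *: b = a * b by [].
  rewrite !sE; case: m {E dX} => [|m] /=; first by rewrite expr0 expr1; ring.
  by rewrite -natr1 !exprS expr0; ring.
- have z k : exp_inv k 0 = 0 by rewrite /exp_inv ltxx.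
  rewrite !z mulr0 addr0.
  have E : (fun h => h^-1 *: ((exp_inv m \o shift 0) (h *: 1) - exp_inv m 0)) @ (0 : R)^'
      --> (0 : R).
    have [C C0 HC] := exp_inv_bound m.+1.
    apply/cvgrPdist_lt => e e0; near=> h.
    rewrite sub0r normrN /= z subr0 addr0 (_ : h *: 1 = h); last exact: mulr1.
    (* Dividing by h raises the index by one, so the difference quotient at 0 is again a member of
       the family and tends to 0 by the bound. *)
    have -> : h^-1 *: exp_inv m h = exp_inv m.+1 h.
      rewrite /exp_inv; case: ifP => _; last exact: scaler0.
      by rewrite exprS -mulrA.
    apply: le_lt_trans (HC h) _; rewrite -ltr_pdivlMl//.
    by near: h; apply: dnbhs0_lt; rewrite mulr_gt0// invr_gt0.
  by apply: DeriveDef; [apply: cvgP E|exact/cvg_lim].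
Unshelve. all: by end_near. Qed.

(** Differentiation raises the index of [exp_inv], so m stays free in the induction on k. *)
Lemma Ck_exp_inv k m n (U : set 'rV[R]_n) (u : 'rV[R]_n -> R) :
  open U -> Cinf U u -> Ck k U (exp_inv m \o u).
Proof.
move=> oU Cu.
have dg l t : differentiable (exp_inv l) t.
  by apply/derivable1_diffP; have [] := exp_inv_derive l t.
have dc l x : U x -> differentiable (exp_inv l \o u) x.
  move=> Ux; apply: differentiable_comp; last exact: dg.
  exact: Cinf_differentiable Cu Ux.
elim: k m => [|k IHk] m /=.
  by move=> x Ux; apply: differentiable_continuous; exact: dc.
split=> [x|j]; first exact: dc.
apply: (@Ck_ext _ _ _ _ (fun x => (- m%:R * (exp_inv m.+1 \o u) x +
                                   (exp_inv m.+2 \o u) x) * partial j u x)) => //.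
  move=> x; rewrite inE => Ux; have du := Cinf_differentiable Cu Ux.
  rewrite [RHS]deriveE; last exact: dc.
  rewrite diff_comp//= (_ : 'd u x _ = partial j u x); last by rewrite -deriveE.
  rewrite -[X in _ = 'd _ _ X]mulr1 [RHS]linearZ -deriveE//= mulrC.
  by have [_ ->] := exp_inv_derive m (u x).
apply: Ck_mul => //; last exact: Cinf_partial.
apply: Ck_add => //; apply: Ck_mul => //; exact: Ck_cst.
Qed.

(** The support is located coordinate by coordinate, in a cube, because a cube is compact as a
    product of segments. *)
Lemma bump n (c : 'rV[R]_n) (r : R) : 0 < r -> exists beta : 'rV[R]_n -> R,
  [/\ Cinf setT beta, beta c = 1 &
      forall x, beta x != 0 -> forall j, `|x 0 j - c 0 j| <= r].
Proof.
(* This is r^2 - |x - c|^2, positive exactly inside the Euclidean ball; it is written with sums and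
   products alone so that [Ck_add] and [Ck_mul] apply directly. *)
move=> r0; pose u (x : 'rV[R]_n) : R := r ^+ 2 + - 1 * \sum_j ((x 0 j + - c 0 j) * (x 0 j + - c 0 j)).
have e0 : exp_inv 0 (r ^+ 2) != 0.
  by rewrite /exp_inv exprn_gt0// expr0 mul1r gt_eqF// expR_gt0.
exists (fun x => (exp_inv 0 (r ^+ 2))^-1 * (exp_inv 0 \o u) x); split.
- have Cc k (a : R) : Ck k [set: 'rV[R]_n] (fun=> a) by exact: Ck_cst.
  have oT : open [set: 'rV[R]_n] by exact: openT.
  move=> k; apply: Ck_mul => //; apply: Ck_exp_inv => // l.
  apply: Ck_add => //; apply: Ck_mul => //; apply: Ck_sum => // j.
  by apply: Ck_mul => //; apply: Ck_add => //; exact: Ck_coord.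
- rewrite /= /u big1 ?mulr0 ?addr0 ?mulVf// => j _.
  by rewrite subrr mulr0.
move=> x; rewrite mulf_eq0 negb_or => /andP[_ /=]; rewrite /exp_inv.
case: ifPn; last by rewrite eqxx.
rewrite /u mulN1r subr_gt0 => ux _ j.
have H : (x 0 j - c 0 j) ^+ 2 <= r ^+ 2.
  rewrite (le_trans _ (ltW ux))// (bigD1 j)//= -expr2 lerDl sumr_ge0// => i _.
  by rewrite -expr2 sqr_ge0.
by rewrite -ler_sqr ?nnegrE ?normr_ge0 ?(ltW r0)// real_normK ?num_real.
Qed.

End Bump.

(** * Vector fields on a manifold *)

Section ManifoldCalculus.
Context {R : realType} (M : manifold R).
Implicit Types (p q z c : M) (h k : M -> R) (X Y Z : vfield M) (O : set M).

Definition chart_sub c O := chart c @` (chart_dom c `&` O).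

Lemma chart_sub_center p O : O p -> chart_sub p O (chart p p).
Proof. by move=> Op; exists p => //; split=> //; exact: chart_dom_center. Qed.

Lemma open_chart_sub c O : open O -> open (chart_sub c O).
Proof.
move=> oO; rewrite openE => _ [z [cz Oz] <-].
have iz : chart_img c (chart c z) by exists z.
have nO : nbhs (param c (chart c z)) O.
  by rewrite chartK ?inE//; exact: open_nbhs_nbhs.
have nI := open_nbhs_nbhs (conj (chart_img_open (c := c)) iz).
have nP : nbhs (chart c z) (param c @^-1` O) by exact: (param_continuous iz) O nO.
apply: filterS2 nI nP => _ [w cw <-] /= Ow.
by exists w => //; split=> //; move: Ow; rewrite chartK ?inE.
Qed.

Lemma chart_subP c O x : chart_sub c O x ->
  [/\ chart_dom c (param c x), O (param c x) & chart c (param c x) = x].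
Proof. by move=> [z [cz Oz] <-]; rewrite chartK ?inE. Qed.

Lemma near_chart c z O : chart_dom c z -> open O -> O z ->
  \forall x \near chart c z,
    [/\ chart_dom c (param c x), O (param c x) & chart c (param c x) = x].
Proof.
move=> cz oO Oz; have U : chart_sub c O (chart c z) by exists z.
have nU : nbhs (chart c z) (chart_sub c O).
  exact: open_nbhs_nbhs (conj (open_chart_sub oO) U).
by apply: filterS nU => x /chart_subP.
Qed.

(** Coordinate functions are smooth only on their chart domain, yet brackets differentiate them
    twice; hence smoothness relative to an open set. *)
Definition smooth_on O h := forall c, Cinf (chart_sub c O) (h \o param c).

Lemma smooth_fun_on O h : smooth_fun h -> smooth_on O h.
Proof.
move=> sh c k; apply: Ck_sub (sh c k) => _ [z [cz _] <-].
by exists z.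
Qed.

Lemma smooth_onT h : smooth_on setT h -> smooth_fun h.
Proof. by move=> sh c; have := sh c; rewrite /chart_sub setIT. Qed.

Lemma smooth_on_coord c i : smooth_on (chart_dom c) (coord c i).
Proof. by move=> d; exact: chart_transition. Qed.

Lemma smooth_onD O h k : open O -> smooth_on O h -> smooth_on O k ->
  smooth_on O (fun z => h z + k z).
Proof. by move=> oO sh sk c l; apply: (Ck_add (open_chart_sub oO) (sh c l) (sk c l)). Qed.

Lemma smooth_onM O h k : open O -> smooth_on O h -> smooth_on O k ->
  smooth_on O (fun z => h z * k z).
Proof. by move=> oO sh sk c l; apply: (Ck_mul (open_chart_sub oO) (sh c l) (sk c l)). Qed.

Lemma smooth_on_cst O a : smooth_on O (fun=> a).
Proof. by move=> c l; exact: Ck_cst. Qed.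

Lemma smooth_onB O h k : open O -> smooth_on O h -> smooth_on O k ->
  smooth_on O (fun z => h z - k z).
Proof.
move=> oO sh sk; rewrite (_ : (fun _ => _) = fun z => h z + -1 * k z).
  by apply: smooth_onD => //; apply: smooth_onM => //; exact: smooth_on_cst.
by apply/funext => z; rewrite mulN1r.
Qed.

Lemma smooth_on_ext O h k : open O -> (forall z, O z -> h z = k z) ->
  smooth_on O h -> smooth_on O k.
Proof.
move=> oO hk sh c l; apply: Ck_ext (sh c l); first exact: open_chart_sub.
by move=> x; rewrite inE => /chart_subP[_ /hk].
Qed.

(** The chart attached to p is the one in which [vderiv p] is computed, so this is the condition
    under which the rules for sums and products hold at p. *)
Definition diff_at p h := differentiable (h \o param p) (chart p p).

Lemma smooth_on_differentiable O h c p : open O -> smooth_on O h ->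
  chart_dom c p -> O p -> differentiable (h \o param c) (chart c p).
Proof.
move=> oO sh cp Op; apply: Cinf_differentiable (sh c) _.
by exists p.
Qed.

Lemma smooth_on_diff_at O h p : open O -> smooth_on O h -> O p -> diff_at p h.
Proof.
by move=> oO sh; apply: smooth_on_differentiable => //; exact: chart_dom_center.
Qed.

Lemma smooth_diff_at h p : smooth_fun h -> diff_at p h.
Proof.
move=> sh; apply: (@smooth_on_diff_at setT) => //; first exact: openT.
exact: smooth_fun_on.
Qed.

Lemma near_eq_partial n (u w : 'rV[R]_n -> R) x i :
  (\forall y \near x, u y = w y) -> partial i u x = partial i w x.
Proof. exact: Defs.near_eq_derive. Qed.

Lemma vderiv_near O h k p v : open O -> O p -> (forall q, O q -> h q = k q) ->
  vderiv p v h = vderiv p v k.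
Proof.
move=> oO Op hk; apply: eq_bigr => i _; congr (_ * _); apply: near_eq_partial.
apply: filterS (near_chart (chart_dom_center p) oO Op) => x [_ /hk + _].
exact.
Qed.

Lemma paramK p : param p (chart p p) = p.
Proof. by rewrite chartK// inE; exact: chart_dom_center. Qed.

Lemma vderivD p v h k : diff_at p h -> diff_at p k ->
  vderiv p v (fun q => h q + k q) = vderiv p v h + vderiv p v k.
Proof.
move=> dh dk; rewrite /vderiv -big_split; apply: eq_bigr => i _ /=.
by rewrite -mulrDr; congr (_ * _); exact: partialD.
Qed.

Lemma vderivM p v h k : diff_at p h -> diff_at p k ->
  vderiv p v (fun q => h q * k q) = h p * vderiv p v k + k p * vderiv p v h.
Proof.
move=> dh dk; rewrite /vderiv !mulr_sumr -big_split; apply: eq_bigr => i _ /=.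
rewrite [h p * _]mulrCA [k p * _]mulrCA -mulrDr; congr (_ * _).
by rewrite [LHS]partialM//= paramK.
Qed.

Lemma vderiv_cst p v a : vderiv p v (fun=> a) = 0.
Proof. by rewrite /vderiv big1// => i _; rewrite [partial _ _ _]partial_cst mulr0. Qed.

Lemma diff_at_cst p a : diff_at p (fun=> a).
Proof. exact: differentiable_cst. Qed.

Lemma diff_atM p h k : diff_at p h -> diff_at p k -> diff_at p (fun q => h q * k q).
Proof. by move=> dh dk; exact: differentiableM. Qed.

Lemma diff_atZ p a h : diff_at p h -> diff_at p (fun q => a * h q).
Proof. by move=> dh; apply: diff_atM => //; exact: diff_at_cst. Qed.

Lemma diff_at_sum m (h : 'I_m -> M -> R) p : (forall j, diff_at p (h j)) ->
  diff_at p (fun q => \sum_j h j q).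
Proof.
move=> dh; rewrite /diff_at (_ : _ \o _ = \sum_j (h j \o param p)).
  exact: differentiable_sum.
by apply/funext => x; rewrite fct_sumE.
Qed.

Lemma vderivZ p v a h : diff_at p h ->
  vderiv p v (fun q => a * h q) = a * vderiv p v h.
Proof.
move=> dh; rewrite vderivM//; last exact: diff_at_cst.
by rewrite vderiv_cst mulr0 addr0.
Qed.

Lemma vderivB p v h k : diff_at p h -> diff_at p k ->
  vderiv p v (fun q => h q - k q) = vderiv p v h - vderiv p v k.
Proof.
move=> dh dk; rewrite -mulN1r -vderivZ// -vderivD//; last exact: diff_atZ.
by congr vderiv; apply/funext => q; rewrite mulN1r.
Qed.

Lemma vderiv_sum m (h : 'I_m -> M -> R) p v : (forall j, diff_at p (h j)) ->
  vderiv p v (fun q => \sum_j h j q) = \sum_j vderiv p v (h j).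
Proof.
move=> dh; rewrite /vderiv exchange_big; apply: eq_bigr => i _ /=.
rewrite -mulr_sumr; congr (_ * _).
by rewrite -[RHS](@partial_sum _ _ _ (fun j => h j \o param p)).
Qed.

Lemma vderiv0 p h : vderiv p 0 h = 0.
Proof. by rewrite /vderiv big1// => i _; rewrite mxE mul0r. Qed.

Lemma vderivDv p v w h : vderiv p (v + w) h = vderiv p v h + vderiv p w h.
Proof. by have := vderiv_linear p h 1 v w; rewrite scale1r mul1r. Qed.

Lemma vderivZv p a v h : vderiv p (a *: v) h = a * vderiv p v h.
Proof. by have := vderiv_linear p h a v 0; rewrite vderiv0 !addr0. Qed.

Lemma vderiv_sumv m p (v : 'I_m -> 'rV[R]_(mdim M)) h :
  vderiv p (\sum_j v j) h = \sum_j vderiv p (v j) h.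
Proof.
by elim/big_rec2: _ => [|j y x _ <-]; [exact: vderiv0|exact: vderivDv].
Qed.

Lemma vderiv_coord p v i : vderiv p v (coord p i) = v 0 i.
Proof.
rewrite [in RHS](row_sum_delta v) summxE; apply: eq_bigr => j _.
by rewrite [partial _ _ _]derive_chart !mxE.
Qed.

Lemma differentiable_transition c z : chart_dom c z ->
  differentiable (chart c \o param z) (chart z z).
Proof.
move=> cz; apply: differentiable_row => j.
exact: smooth_on_differentiable (@chart_dom_open _ _ c) (@smooth_on_coord c j)
  (chart_dom_center z) cz.
Qed.

Lemma differentiable_transitionV c z : chart_dom c z ->
  differentiable (chart z \o param c) (chart c z).
Proof.
move=> cz; apply: differentiable_row => j.
exact: smooth_on_differentiable (@chart_dom_open _ _ z) (@smooth_on_coord z j)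
  cz (chart_dom_center z).
Qed.

(** [vderiv z] is computed in the chart of z, which changes with z. The chain rule for the
    transition map moves the computation to a fixed chart [c], where the result can be
    differentiated again. *)
Lemma vderiv_chart c z v h : chart_dom c z ->
  differentiable (h \o param c) (chart c z) ->
  vderiv z v h =
  \sum_j vderiv z v (coord c j) * partial j (h \o param c) (chart c z).
Proof.
move=> cz dh.
have E : chart c (param z (chart z z)) = chart c z by rewrite paramK.
under [RHS]eq_bigr do rewrite /vderiv mulr_suml.
rewrite exchange_big; apply: eq_bigr => i _ /=.
rewrite (near_eq_partial (w := (h \o param c) \o (chart c \o param z))); last first.
  apply: filterS (near_chart (chart_dom_center z) (@chart_dom_open _ _ c) cz).
  by move=> x [_ cx _] /=; rewrite chartK ?inE.
rewrite partial_comp; [rewrite /= E|exact: differentiable_transition|by rewrite /= E].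
by rewrite mulr_sumr; apply: eq_bigr => j _; rewrite mulrA mulrAC.
Qed.

Lemma vderiv_frame c z i h : chart_dom c z -> diff_at z h ->
  vderiv z (frame c i z) h = partial i (h \o param c) (chart c z).
Proof.
move=> cz dh.
have E : chart z (param c (chart c z)) = chart z z by rewrite chartK ?inE.
rewrite (near_eq_partial (w := (h \o param z) \o (chart z \o param c))); last first.
  apply: filterS (near_chart cz (@chart_dom_open _ _ z) (chart_dom_center z)).
  by move=> x [_ cx _] /=; rewrite chartK ?inE.
rewrite partial_comp; [rewrite /= E|exact: differentiable_transitionV|by rewrite /= E].
by apply: eq_bigr => j _; rewrite mulrC mxE.
Qed.

(** Applying both sides to the coordinates of the chart at z reduces this to [vderiv_chart]. It
    links [metric_smooth], stated on chart frames, with arbitrary fields. *)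
Lemma frame_decomposition c z v : chart_dom c z ->
  v = \sum_j vderiv z v (coord c j) *: frame c j z.
Proof.
move=> cz; apply/rowP => k; rewrite -[LHS](vderiv_coord z) summxE.
rewrite (vderiv_chart v cz); last first.
  exact: smooth_on_differentiable (@chart_dom_open _ _ z) (@smooth_on_coord z k)
    cz (chart_dom_center z).
by apply: eq_bigr => j _; rewrite !mxE.
Qed.

Lemma frame_center p (v : 'rV[R]_(mdim M)) : v = \sum_j v 0 j *: frame p j p.
Proof.
rewrite {1}(frame_decomposition v (chart_dom_center p)).
by apply: eq_bigr => j _; rewrite vderiv_coord.
Qed.

Lemma smooth_on_deriv O X h : open O -> smooth_vf X -> smooth_on O h ->
  smooth_on O (deriv X h).
Proof.
move=> oO sX sh c k; have oU := open_chart_sub oO.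
apply: (@Ck_ext _ _ _ _ (fun x => \sum_j (deriv X (coord c j) \o param c) x *
    partial j (h \o param c) x)) => //.
  move=> x; rewrite inE => Ux; have [cx Ox xE] := chart_subP Ux.
  rewrite /= /deriv (vderiv_chart _ cx) ?xE//.
  by apply: Cinf_differentiable (sh c) Ux.
apply: Ck_sum => // j; apply: Ck_mul => //; last exact: Cinf_partial.
by apply: Ck_sub (sX c j k) => _ [z [cz _] <-]; exists z.
Qed.

Lemma smooth_deriv X h : smooth_vf X -> smooth_fun h -> smooth_fun (deriv X h).
Proof.
move=> sX sh; apply: smooth_onT; apply: smooth_on_deriv => //; first exact: openT.
exact: smooth_fun_on.
Qed.

End ManifoldCalculus.

(** * The bracket as a commutator, and the Jacobi identity *)

Section LieBracket.
Context {R : realType} (M : manifold R).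
Implicit Types (p q z c : M) (h k : M -> R) (X Y Z : vfield M) (O : set M).

(** By definition the bracket is the commutator on the coordinates of the chart at p only. For a
    general [h] the second-order terms of X(Y h) and Y(X h) coincide by [partialC], and the
    first-order terms are those of the coordinates. *)
Lemma deriv_bracket O X Y h p : open O -> O p -> smooth_vf X -> smooth_vf Y ->
  smooth_on O h ->
  deriv (bracket X Y) h p = deriv X (deriv Y h) p - deriv Y (deriv X h) p.
Proof.
move=> oO Op sX sY sh.
have dp := chart_dom_center p; have oD := @chart_dom_open _ _ p.
have U : chart_sub p O (chart p p) by exact: chart_sub_center.
(* The coordinate derivatives of [h] in the one chart at p, as functions on M that can be
   differentiated once more. *)
pose hj j : M -> R := partial j (h \o param p) \o chart p.
have hjE j : \forall x \near chart p p, partial j (h \o param p) x = (hj j \o param p) x.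
  by apply: filterS (near_chart dp oD dp) => x [_ _ E]; rewrite /= /hj /= E.
have dhj j : diff_at p (hj j).
  apply: near_eq_differentiable (hjE j) _.
  by apply: Cinf_differentiable U; exact: Cinf_partial.
have E W V : smooth_vf W -> deriv V (deriv W h) p =
    \sum_j (deriv V (deriv W (coord p j)) p * partial j (h \o param p) (chart p p)) +
    \sum_j \sum_i W p 0 j * V p 0 i *
      partial i (partial j (h \o param p)) (chart p p).
  move=> sW.
  have dW j : diff_at p (deriv W (coord p j)).
    apply: (smooth_on_diff_at oD _ dp).
    exact: smooth_on_deriv oD sW (@smooth_on_coord _ _ p j).
  rewrite [LHS](@vderiv_near _ _ (chart_dom p `&` O) _
    (fun q => \sum_j deriv W (coord p j) q * hj j q)) //; last 2 first.
  - exact: openI.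
  - move=> q [pq Oq]; rewrite /deriv (vderiv_chart _ pq)//.
    exact: smooth_on_differentiable sh pq Oq.
  rewrite vderiv_sum => [|j]; last exact: diff_atM.
  rewrite -big_split; apply: eq_bigr => j _ /=.
  rewrite vderivM// [RHS]addrC; congr (_ + _); last exact: mulrC.
  rewrite /deriv vderiv_coord mulr_sumr; apply: eq_bigr => i _.
  by rewrite -(near_eq_partial _ (hjE j)) mulrA.
rewrite !E//.
have -> : \sum_j \sum_i Y p 0 j * X p 0 i * partial i (partial j (h \o param p)) (chart p p)
  = \sum_j \sum_i X p 0 j * Y p 0 i * partial i (partial j (h \o param p)) (chart p p).
  rewrite exchange_big; apply: eq_bigr => j _; apply: eq_bigr => i _ /=.
  by rewrite (mulrC (Y p 0 i)) (partialC j i (open_chart_sub oO) U (sh p 2)).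
rewrite opprD addrACA subrr addr0 -sumrB; apply: eq_bigr => j _.
by rewrite mxE mulrBl.
Qed.

(** The defining chart of [bracket X Y] moves with the point; on the coordinates of a fixed chart
    the commutator formula takes over. *)
Lemma smooth_vf_bracket X Y : smooth_vf X -> smooth_vf Y -> smooth_vf (bracket X Y).
Proof.
move=> sX sY c i.
have oD := @chart_dom_open _ _ c.
suff : smooth_on (chart_dom c) (deriv (bracket X Y) (coord c i)).
  by move=> /(_ c); rewrite /chart_sub setIid.
have sc := @smooth_on_coord _ _ c i.
apply: (@smooth_on_ext _ _ _ (fun p => deriv X (deriv Y (coord c i)) p -
                                       deriv Y (deriv X (coord c i)) p)) => //.
  by move=> p cp; rewrite (deriv_bracket oD cp).
by apply: smooth_onB => //; do 2!apply: smooth_on_deriv => //.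
Qed.

Lemma bracketC X Y : bracket Y X = - bracket X Y.
Proof. by apply/funext => p; apply/rowP => i; rewrite !mxE opprB. Qed.

(** On a coordinate function the sum consists of twelve third derivatives: each of the six orders of
    X, Y, Z occurs twice, with opposite signs. *)
Lemma jacobi X Y Z p : smooth_vf X -> smooth_vf Y -> smooth_vf Z ->
  bracket X (bracket Y Z) p + bracket Y (bracket Z X) p + bracket Z (bracket X Y) p = 0.
Proof.
move=> sX sY sZ; apply/rowP => i.
have dp := chart_dom_center p; have oD := @chart_dom_open _ _ p.
have sc := @smooth_on_coord _ _ p i.
have E W V T : smooth_vf W -> smooth_vf V -> smooth_vf T ->
    bracket W (bracket V T) p 0 i =
    deriv W (deriv V (deriv T (coord p i))) p - deriv W (deriv T (deriv V (coord p i))) p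
    - (deriv V (deriv T (deriv W (coord p i))) p - deriv T (deriv V (deriv W (coord p i))) p).
  move=> sW sV sT; rewrite mxE.
  have s2 A1 A2 : smooth_vf A1 -> smooth_vf A2 ->
      diff_at p (deriv A1 (deriv A2 (coord p i))).
    move=> sA1 sA2; apply: (smooth_on_diff_at oD _ dp).
    by do 2!apply: smooth_on_deriv => //.
  rewrite (deriv_bracket oD dp sV sT (smooth_on_deriv oD sW sc)).
  congr (_ - _); rewrite -[RHS]vderivB; [|exact: s2|exact: s2].
  by apply: (vderiv_near _ oD dp) => q pq; rewrite (deriv_bracket oD pq).
have D (u v : 'rV[R]_(mdim M)) : (u + v) 0 i = u 0 i + v 0 i by rewrite mxE.
rewrite !D (E X Y Z)// (E Y Z X)// (E Z X Y)// [RHS]mxE.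
set a1 := deriv X (deriv Y _) p; set a2 := deriv X (deriv Z _) p.
set b1 := deriv Y (deriv Z _) p; set b2 := deriv Y (deriv X _) p.
set c1 := deriv Z (deriv X _) p; set c2 := deriv Z (deriv Y _) p.
by ring.
Qed.

End LieBracket.

Section Metric.
Context {R : realType} (M : srmanifold R).
Implicit Types (p q z c : M) (v w : 'rV[R]_(mdim M)) (X Y Z : vfield M).

Lemma metricDr p v w w' : metric p v (w + w') = metric p v w + metric p v w'.
Proof. by have := metric_linear p v 1 w w'; rewrite scale1r mul1r. Qed.

Lemma metricZr p v a w : metric p v (a *: w) = a * metric p v w.
Proof. by have := metric_linear p v a w 0; rewrite metric0r !addr0. Qed.

Lemma metricDl p v v' w : metric p (v + v') w = metric p v w + metric p v' w.
Proof. by rewrite metric_sym metricDr !(metric_sym p w). Qed.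

Lemma metricZl p v a w : metric p (a *: v) w = a * metric p v w.
Proof. by rewrite metric_sym metricZr metric_sym. Qed.

Lemma metricNr p v w : metric p v (- w) = - metric p v w.
Proof. by rewrite -scaleN1r metricZr mulN1r. Qed.

Lemma metricNl p v w : metric p (- v) w = - metric p v w.
Proof. by rewrite -scaleN1r metricZl mulN1r. Qed.

Lemma metric_sumr p v m (w : 'I_m -> 'rV[R]_(mdim M)) :
  metric p v (\sum_j w j) = \sum_j metric p v (w j).
Proof.
by elim/big_rec2: _ => [|j y x _ <-]; [exact: metric0r|exact: metricDr].
Qed.

Lemma metric_suml p m (v : 'I_m -> 'rV[R]_(mdim M)) w :
  metric p (\sum_j v j) w = \sum_j metric p (v j) w.
Proof.
by rewrite metric_sym metric_sumr; apply: eq_bigr => j _; rewrite metric_sym.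
Qed.

Lemma ipC X Y : ip X Y = ip Y X.
Proof. by apply/funext => p; exact: metric_sym. Qed.

Lemma smooth_ip X Y : smooth_vf X -> smooth_vf Y -> smooth_fun (ip X Y).
Proof.
move=> sX sY c k; have oU : open (chart_img c) by exact: chart_img_open.
apply: (@Ck_ext _ _ _ _ (fun x => \sum_i \sum_j
  (deriv X (coord c i) \o param c) x * (deriv Y (coord c j) \o param c) x *
  ((fun p => metric p (frame c i p) (frame c j p)) \o param c) x)) => //.
  move=> x; rewrite inE => -[z cz <-] /=; rewrite chartK ?inE//.
  rewrite /ip [X z in RHS](frame_decomposition _ cz) [Y z in RHS](frame_decomposition _ cz).
  rewrite metric_suml; apply: eq_bigr => i _; rewrite metric_sumr.
  by apply: eq_bigr => j _; rewrite metricZl metricZr mulrA.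
apply: Ck_sum => // i; apply: Ck_sum => // j.
apply: Ck_mul => //; last exact: metric_smooth.
by apply: Ck_mul => //; [exact: sX|exact: sY].
Qed.

End Metric.

(** * Extension of tangent vectors to smooth vector fields *)

Section Extension.
Context {R : realType} (M : manifold R).
Implicit Types (p q z c : M) (X Y Z : vfield M).

Lemma cube_compact n (c : 'rV[R]_n) (r : R) :
  compact [set x : 'rV[R]_n | forall j, `|x 0 j - c 0 j| <= r].
Proof.
rewrite (_ : [set _ | _] =
    [set x : 'rV[R]_n | forall j, `[c 0 j - r, c 0 j + r]%classic (x ord0 j)]).
  apply: (@rV_compact _ _ (fun j : 'I_n => `[c 0 j - r, c 0 j + r]%classic)) => j.
  exact: segment_compact.
by apply/seteqP; split=> x /= H j; have := H j; rewrite in_itv /= ler_distl.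
Qed.

Lemma cube_in_open n (c : 'rV[R]_n) (U : set 'rV[R]_n) : open U -> U c ->
  exists2 r : R, 0 < r & [set x : 'rV[R]_n | forall j, `|x 0 j - c 0 j| <= r] `<=` U.
Proof.
move=> oU Uc; have /nbhs_ballP [e e0 eU] := open_nbhs_nbhs (conj oU Uc).
exists (e / 2) => [|x H]; first by rewrite /= divr_gt0.
apply: eU; split=> // i j; rewrite (ord1 i) /ball /= distrC.
by rewrite (le_lt_trans (H j))// ltr_pdivrMr// ltr_pMr// ltr1n.
Qed.

(* The constant extension of v in the chart at p is cut off by a bump function
   supported in a cube K; the image of K is compact, hence closed since M is
   Hausdorff, so that the extension by zero is smooth. *)
Lemma vf_extension p (v : 'rV[R]_(mdim M)) : exists2 X, smooth_vf X & X p = v.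
Proof.
have pI : chart_img p (chart p p) by exists p => //; exact: chart_dom_center.
have [r r0 rI] := cube_in_open (chart_img_open (c := p)) pI.
set K := [set x | _] in rI.
have [beta [Cb b1 bK]] := bump (chart p p) r0.
pose C := param p @` K.
have oC : open (~` C).
  apply: closed_openC; apply: (compact_closed (@mhausdorff _ M)).
  apply: continuous_compact; last exact: cube_compact.
  apply: continuous_in_subspaceT => x; rewrite inE => Kx.
  by apply: param_continuous; exact: rI.
pose W z : 'rV[R]_(mdim M) := \sum_j v 0 j *: frame p j z.
pose X : vfield M := fun z => if z \in chart_dom p then beta (chart p z) *: W z else 0.
have X0 z : ~ C z -> X z = 0.
  move=> Cz; rewrite /X; case: ifPn => //; rewrite inE => pz.
  have [->|/bK Kz] := eqVneq (beta (chart p z)) 0; first by rewrite scale0r.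
  by case: Cz; exists (chart p z) => //; rewrite chartK ?inE.
exists X; last first.
  rewrite /X ifT; last by rewrite inE; exact: chart_dom_center.
  by rewrite b1 scale1r [RHS](frame_center p).
move=> c i k; apply: Ck_local => _ [z cz <-].
(* C lies in the chart domain of p, so this domain and the complement of C cover M; the field has a
   smooth formula on the first and vanishes on the second. *)
have [pz|pz] := pselect (chart_dom p z).
  have oV : open (chart_sub c (chart_dom p)).
    by apply: open_chart_sub; exact: chart_dom_open.
  exists (chart_sub c (chart_dom p)); first by split=> //; exists z.
  pose phi := chart p \o param c.
  apply: (@Ck_ext _ _ _ _ (fun x => (beta \o phi) x * \sum_j (v 0 j *
      (partial j (coord c i \o param p) \o phi) x))) => //.
    move=> x; rewrite inE => /chart_subP[cx px xE] /=.
    rewrite /X /deriv ifT ?inE// vderivZv vderiv_sumv; congr (_ * _).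
    apply: eq_bigr => j _; rewrite vderivZv vderiv_frame//.
    have oc := @chart_dom_open _ _ c.
    exact: smooth_on_diff_at oc (@smooth_on_coord _ _ c i) cx.
  have Cphi j : Ck k (chart_sub c (chart_dom p)) (fun x => phi x 0 j).
    exact: (@smooth_on_coord _ _ p j c k).
  apply: Ck_mul => //; first by apply: (Ck_comp (V := setT)) => //; exact: Cb.
  apply: Ck_sum => // j; apply: Ck_mul => //; first exact: Ck_cst.
  apply: (Ck_comp (V := chart_sub p (chart_dom c))) => //.
    by move=> x /chart_subP[cx px _]; exists (param c x).
  by apply: Cinf_partial; exact: (@smooth_on_coord _ _ c i p).
have oV : open (chart_sub c (~` C)) by exact: open_chart_sub.
exists (chart_sub c (~` C)).
  split=> //; exists z => //; split=> // -[x Kx xz]; apply: pz; rewrite -xz.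
  by have [w pw <-] := rI _ Kx; rewrite chartK ?inE.
apply: (@Ck_ext _ _ _ _ (fun=> 0)) => //; last exact: Ck_cst.
move=> x; rewrite inE => /chart_subP[_ Cx _].
by rewrite /= /deriv X0// vderiv0.
Qed.

End Extension.

(** * Independence of the representatives *)

Section BulletProduct.
Context {R : realType} (M : srmanifold R).
Implicit Types (p : M) (X Y Z : vfield M).

Lemma bullet_ip_eq p v w (omega tau : vfield M -> M -> R) :
  represents p v omega -> represents p w tau ->
  bullet_ip omega tau p = metric p v w.
Proof.
move=> rv rw; rewrite /bullet_ip.
have xgetP u (sigma : vfield M -> M -> R) : represents p u sigma ->
    represents p (xget 0 [set v | represents p v sigma]) sigma.
  by move=> ru; apply: (@xgetPex _ 0 [set v | represents p v sigma]); exists u.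
move: (xgetP v omega rv) (xgetP w tau rw).
set v' := xget _ _; set w' := xget _ _ => rv' rw'.
(* The representatives are exchanged one at a time: <v', w'> = omega(w') = <v, w'> = tau(v) = <v,
   w>. Evaluating [omega] and [tau] needs fields through w' and v. *)
have [Zw sZw Zwp] := vf_extension p w'; have [Zv sZv Zvp] := vf_extension p v.
rewrite -[in LHS]Zwp -rv'// rv// Zwp metric_sym -[in LHS]Zvp -rw'// rw// Zvp.
exact: metric_sym.
Qed.

Lemma bullet_ipC (omega tau : vfield M -> M -> R) :
  bullet_ip omega tau = bullet_ip tau omega.
Proof. by apply/funext => p; exact: metric_sym. Qed.

End BulletProduct.

(** * Symmetries of the Koszul form and of the curvature *)

Section Koszul.
Context {R : realType} (M : srmanifold R).
Implicit Types (p : M) (X Y Z T W : vfield M).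

Lemma ipNr X Y p : ip X (- Y) p = - ip X Y p.
Proof. exact: metricNr. Qed.

Lemma ipNl X Y p : ip (- X) Y p = - ip X Y p.
Proof. exact: metricNl. Qed.

(** Metric compatibility of the Levi-Civita connection in lower form; with the bracket skew, it is
    an identity between the six Koszul terms. *)
Lemma koszul_metric X Y Z p :
  koszul X Y Z p + koszul X Z Y p = deriv X (ip Y Z) p.
Proof.
rewrite /koszul (ipC Z X) (ipC Y X) (ipC Z Y) (bracketC Y Z) (bracketC Z X)
  (bracketC X Y) !ipNr.
move: (deriv X (ip Y Z) p) (deriv Y (ip X Z) p) (deriv Z (ip X Y) p)
  (ip X (bracket Y Z) p) (ip Y (bracket Z X) p) (ip Z (bracket X Y) p) => a b c d e f.
by field.
Qed.

(** Absence of torsion in lower form: the lower derivatives of Y along X and of X along Y differ by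
    <[X, Y], _>. *)
Lemma koszul_torsion X Y Z p :
  koszul X Y Z p = koszul Y X Z p + ip Z (bracket X Y) p.
Proof.
rewrite /koszul (ipC Z X) (ipC Y X) (ipC Z Y) (bracketC Y Z) (bracketC Z X)
  (bracketC X Y) !ipNr.
move: (deriv X (ip Y Z) p) (deriv Y (ip X Z) p) (deriv Z (ip X Y) p)
  (ip X (bracket Y Z) p) (ip Y (bracket Z X) p) (ip Z (bracket X Y) p) => a b c d e f.
by field.
Qed.

Lemma derivN X h : deriv (- X) h = fun p => - deriv X h p.
Proof.
by apply/funext => p; rewrite /deriv -mulN1r -vderivZv scaleN1r.
Qed.

Lemma derivD X (h k : M -> R) p : diff_at p h -> diff_at p k ->
  deriv X (fun q => h q + k q) p = deriv X h p + deriv X k p.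
Proof. exact: vderivD. Qed.

Lemma vderivN p v (h : M -> R) : diff_at p h ->
  vderiv p v (fun q => - h q) = - vderiv p v h.
Proof.
move=> dh; rewrite -mulN1r -vderivZ//; congr vderiv.
by apply/funext => q; rewrite mulN1r.
Qed.

(** Serves [riemann_skew12], where [Y, X] = - [X, Y] enters the first slot. *)
Lemma koszulNl W Z T p : smooth_vf W -> smooth_vf Z -> smooth_vf T ->
  koszul (- W) Z T p = - koszul W Z T p.
Proof.
move=> sW sZ sT.
have dip (A B : vfield M) : smooth_vf A -> smooth_vf B -> diff_at p (ip A B).
  by move=> sA sB; apply: smooth_diff_at; exact: smooth_ip.
have bN A : smooth_vf A -> bracket A (- W) p = - bracket A W p.
  move=> sA; apply/rowP => i; rewrite !mxE !derivN [deriv A _ p]vderivN ?opprB 1?addrC//.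
    by rewrite opprK addrC.
  apply: (@smooth_on_diff_at _ _ (chart_dom p)); last exact: chart_dom_center.
    exact: chart_dom_open.
  by apply: smooth_on_deriv => //; [exact: chart_dom_open|exact: smooth_on_coord].
have E1 (A B : vfield M) : smooth_vf B -> deriv A (ip B (- W)) p = - deriv A (ip B W) p.
  move=> sB; rewrite -vderivN; last exact: dip.
  by congr vderiv; apply/funext => q; exact: ipNr.
have E2 (A B : vfield M) : smooth_vf B -> ip A (bracket B (- W)) p = - ip A (bracket B W) p.
  by move=> sB; rewrite /ip bN// metricNr.
rewrite /koszul derivN ipNl (ipC (- W) Z) !E1// !E2// (bracketC Z (- W)) (bracketC Z W).
rewrite !ipNr E2// (ipC Z W).
move: (deriv W (ip Z T) p) (deriv Z (ip T W) p) (deriv T (ip Z W) p)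
  (ip W (bracket Z T) p) (ip Z (bracket T W) p) (ip T (bracket W Z) p) => a b c d e f.
by field.
Qed.

Lemma ip_jacobi X Y Z T p : smooth_vf X -> smooth_vf Y -> smooth_vf Z ->
  ip T (bracket X (bracket Y Z)) p + ip T (bracket Y (bracket Z X)) p
  + ip T (bracket Z (bracket X Y)) p = 0.
Proof. by move=> sX sY sZ; rewrite /ip -!metricDr jacobi// metric0r. Qed.

Lemma bracket0r X : bracket X 0 = 0.
Proof.
have d0 (h : M -> R) : deriv 0 h = fun=> 0 by apply/funext => q; exact: vderiv0.
apply/funext => p; apply/rowP => i; rewrite !mxE !d0 subr0.
exact: vderiv_cst.
Qed.

Lemma bracket0l X : bracket 0 X = 0.
Proof. by rewrite bracketC bracket0r oppr0. Qed.

Lemma ip0r X : ip X 0 = fun=> 0.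
Proof. by apply/funext => p; exact: metric0r. Qed.

Lemma koszul0r X Y p : koszul X Y 0 p = 0.
Proof.
rewrite /koszul (ipC 0 X) (ipC 0 (bracket X Y)) bracket0r bracket0l !ip0r.
by rewrite /deriv !vderiv_cst vderiv0; ring.
Qed.

Lemma koszul0l Y Z p : koszul 0 Y Z p = 0.
Proof.
rewrite /koszul (ipC 0 Y) (ipC 0 (bracket Y Z)) bracket0r bracket0l !ip0r.
by rewrite /deriv !vderiv_cst vderiv0; ring.
Qed.

Lemma smooth_koszul X Y Z : smooth_vf X -> smooth_vf Y -> smooth_vf Z ->
  smooth_fun (koszul X Y Z).
Proof.
move=> sX sY sZ; apply: smooth_onT.
have oT : open [set: M] by exact: openT.
have sd (A B C : vfield M) : smooth_vf A -> smooth_vf B -> smooth_vf C ->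
    smooth_on setT (deriv A (ip B C)).
  by move=> sA sB sC; exact: smooth_on_deriv oT sA (smooth_fun_on setT (smooth_ip sB sC)).
have sb (A B C : vfield M) : smooth_vf A -> smooth_vf B -> smooth_vf C ->
    smooth_on setT (ip A (bracket B C)).
  by move=> sA sB sC; exact (smooth_fun_on setT (smooth_ip sA (smooth_vf_bracket sB sC))).
apply: smooth_onM => //; first exact: smooth_on_cst.
apply: smooth_onD => //; last exact: sb.
apply: smooth_onD => //; last exact: sb.
apply: smooth_onB => //; last exact: sb.
apply: smooth_onB => //; last exact: sd.
by apply: smooth_onD => //; exact: sd.
Qed.

Lemma diff_at_koszul X Y Z p : smooth_vf X -> smooth_vf Y -> smooth_vf Z ->
  diff_at p (koszul X Y Z).
Proof. by move=> sX sY sZ; apply: smooth_diff_at; exact: smooth_koszul. Qed.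

End Koszul.

(** * Skew symmetries, first Bianchi identity, pair symmetry *)

Section CurvatureSymmetries.
Context {R : realType} (M : srmanifold R).
Implicit Types (p : M) (X Y Z T : vfield M).

Lemma riemannE X Y Z T p : riemann X Y Z T p =
  deriv X (koszul Y Z T) p - bullet_ip (nabla_flat X T) (nabla_flat Y Z) p
  - (deriv Y (koszul X Z T) p - bullet_ip (nabla_flat Y T) (nabla_flat X Z) p)
  - koszul (bracket X Y) Z T p.
Proof. by []. Qed.

(** Reduces each component of the warped curvature to five separate evaluations. *)
Lemma riemann_eq X Y Z T p (d b d' b' k : R) :
  deriv X (koszul Y Z T) p = d ->
  bullet_ip (nabla_flat X T) (nabla_flat Y Z) p = b ->
  deriv Y (koszul X Z T) p = d' ->
  bullet_ip (nabla_flat Y T) (nabla_flat X Z) p = b' ->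
  koszul (bracket X Y) Z T p = k ->
  riemann X Y Z T p = d - b - (d' - b') - k.
Proof. by move=> <- <- <- <- <-. Qed.

Lemma riemann_skew12 X Y Z T p :
  smooth_vf X -> smooth_vf Y -> smooth_vf Z -> smooth_vf T ->
  riemann X Y Z T p = - riemann Y X Z T p.
Proof.
move=> sX sY sZ sT; rewrite !riemannE (bracketC X Y).
have arith (a b c d e e' : R) : e' = - e -> a - b - (c - d) - e = - (c - d - (a - b) - e').
  by move=> ->; ring.
by apply: arith; apply: koszulNl => //; exact: smooth_vf_bracket.
Qed.

(** In R(X, Y, Z, T) + R(X, Y, T, Z) the products cancel because [bullet_ip] is symmetric, and
    metric compatibility turns the rest into X Y<Z, T> - Y X<Z, T> - [X, Y]<Z, T> = 0. *)
Lemma riemann_skew34 X Y Z T p :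
  smooth_vf X -> smooth_vf Y -> smooth_vf Z -> smooth_vf T ->
  riemann X Y Z T p = - riemann X Y T Z p.
Proof.
move=> sX sY sZ sT; apply/eqP; rewrite -addr_eq0; apply/eqP; rewrite !riemannE.
have oT : open [set: M] by exact: openT.
have E := @deriv_bracket _ _ _ X Y _ p oT I sX sY (smooth_fun_on setT (smooth_ip sZ sT)).
have dK (A B : vfield M) : smooth_vf A -> smooth_vf B ->
    deriv A (deriv B (ip Z T)) p = deriv A (koszul B Z T) p + deriv A (koszul B T Z) p.
  move=> sA sB; rewrite -derivD; [|exact: diff_at_koszul|exact: diff_at_koszul].
  by congr (deriv _ _ p); apply/funext => q; rewrite koszul_metric.
have arith (e k k' d d' a a' b b' m m' n n' : R) : e = d - d' -> k + k' = e ->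
    d = a + a' -> d' = b + b' -> m = m' -> n = n' ->
    a - m - (b - n) - k + (a' - n' - (b' - m') - k') = 0.
  by move=> *; lra.
apply: (arith _ _ _ _ _ _ _ _ _ _ _ _ _ E (koszul_metric _ _ _ _) (dK _ _ sX sY) (dK _ _ sY sX)).
- by rewrite bullet_ipC.
- by rewrite bullet_ipC.
Qed.

Lemma bullet_ip_torsion omega X Y p u v :
  smooth_vf X -> smooth_vf Y ->
  represents p u omega -> represents p v (nabla_flat Y X) ->
  bullet_ip omega (nabla_flat X Y) p =
  bullet_ip omega (nabla_flat Y X) p + omega (bracket X Y) p.
Proof.
move=> sX sY ru rv.
have rw : represents p (v + bracket X Y p) (nabla_flat X Y).
  by move=> Z sZ; rewrite /nabla_flat koszul_torsion [koszul _ _ _ _]rv// metricDl (ipC Z).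
rewrite (bullet_ip_eq ru rw) (bullet_ip_eq ru rv) metricDr ru//.
exact: smooth_vf_bracket.
Qed.

Lemma bianchi X Y Z T p u v w u' v' w' :
  smooth_vf X -> smooth_vf Y -> smooth_vf Z -> smooth_vf T ->
  represents p u (nabla_flat X T) -> represents p v (nabla_flat Y T) ->
  represents p w (nabla_flat Z T) ->
  represents p u' (nabla_flat Z Y) -> represents p v' (nabla_flat X Z) ->
  represents p w' (nabla_flat Y X) ->
  riemann X Y Z T p + riemann Y Z X T p + riemann Z X Y T p = 0.
Proof.
move=> sX sY sZ sT ru rv rw ru' rv' rw'; rewrite !riemannE.
have oT : open [set: M] by exact: openT.
(* Torsion replaces K(B, C, T) by K(C, B, T) + <[B, C], T>, and metric compatibility differentiates
   the last term. Its part K(A, T, [B, C]) cancels the correction from [bullet_ip_torsion]. *)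
have dk (A B C : vfield M) : smooth_vf A -> smooth_vf B -> smooth_vf C ->
    deriv A (koszul B C T) p =
    deriv A (koszul C B T) p + (koszul A (bracket B C) T p + koszul A T (bracket B C) p).
  move=> sA sB sC.
  rewrite koszul_metric -derivD; last 2 first.
  - exact: diff_at_koszul.
  - apply: smooth_diff_at; apply: smooth_ip => //; exact: smooth_vf_bracket.
  by congr (deriv _ _ p); apply/funext => q; rewrite koszul_torsion (ipC T).
(* Here K([B, C], A, T) cancels the bracket term of the curvature of B and C; the remaining terms
   <T, [A, [B, C]]> sum to zero by Jacobi. *)
have kt (A B C : vfield M) : koszul A (bracket B C) T p =
    koszul (bracket B C) A T p + ip T (bracket A (bracket B C)) p.
  exact: koszul_torsion.
have arith (x y z x' y' z' kx ky kz mx my mz nx ny nz jx jy jz : R)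
    (a b c a' b' c' : R) :
    a = a' + mx -> b = b' + my -> c = c' + mz ->
    x = x' + (kx + mx) -> y = y' + (ky + my) -> z = z' + (kz + mz) ->
    kx = nx + jx -> ky = ny + jy -> kz = nz + jz -> jx + jy + jz = 0 ->
    x - a - (y' - b') - nz + (y - b - (z' - c') - nx) + (z - c - (x' - a') - ny) = 0.
  by move=> *; lra.
apply: (arith _ _ _ _ _ _ _ _ _ _ _ _ _ _ _ _ _ _ _ _ _ _ _ _
  (bullet_ip_torsion sY sZ ru ru') (bullet_ip_torsion sZ sX rv rv')
  (bullet_ip_torsion sX sY rw rw') (dk _ _ _ sX sY sZ) (dk _ _ _ sY sZ sX)
  (dk _ _ _ sZ sX sY) (kt _ _ _) (kt _ _ _) (kt _ _ _) (ip_jacobi T p sX sY sZ)).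
Qed.

(** Stated relative to a set of fields so that representability is asked only of its members; it is
    applied to the lifts. *)
Lemma riemann_pair_sym (S : set (vfield M)) p :
  (forall A, S A -> smooth_vf A) ->
  (forall A B, S A -> S B -> exists v, represents p v (nabla_flat A B)) ->
  forall X Y Z T, S X -> S Y -> S Z -> S T ->
  riemann X Y Z T p = riemann Z T X Y p.
Proof.
move=> Ss Sr.
have B A1 A2 A3 A4 : S A1 -> S A2 -> S A3 -> S A4 ->
    riemann A1 A2 A3 A4 p + riemann A2 A3 A1 A4 p + riemann A3 A1 A2 A4 p = 0.
  move=> S1 S2 S3 S4.
  have [u ru] := Sr A1 A4 S1 S4; have [v rv] := Sr A2 A4 S2 S4.
  have [w rw] := Sr A3 A4 S3 S4; have [u' ru'] := Sr A3 A2 S3 S2.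
  have [v' rv'] := Sr A1 A3 S1 S3; have [w' rw'] := Sr A2 A1 S2 S1.
  exact: bianchi (Ss _ S1) (Ss _ S2) (Ss _ S3) (Ss _ S4) ru rv rw ru' rv' rw'.
have s12 A1 A2 A3 A4 : S A1 -> S A2 -> S A3 -> S A4 ->
    riemann A1 A2 A3 A4 p = - riemann A2 A1 A3 A4 p.
  by move=> *; apply: riemann_skew12; exact: Ss.
have s34 A1 A2 A3 A4 : S A1 -> S A2 -> S A3 -> S A4 ->
    riemann A1 A2 A3 A4 p = - riemann A1 A2 A4 A3 p.
  by move=> *; apply: riemann_skew34; exact: Ss.
(* With these names the left-hand side is the third term of the Bianchi identity for X, Y, Z. In the
   sum of the four identities below, the first two terms of each cancel in pairs by skewness in the
   last two arguments, leaving 2 R(Z, X, Y, T) - 2 R(Y, T, Z, X) = 0. *)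
move=> Z X Y T SZ SX SY ST.
have arith (x1 x2 x3 y1 y2 y3 z1 z2 z3 t1 t2 t3 w v : R) :
    x1 + x2 + x3 = 0 -> y1 + y2 + y3 = 0 -> z1 + z2 + z3 = 0 -> t1 + t2 + t3 = 0 ->
    x1 = - t2 -> x2 = - y1 -> y2 = - z1 -> z2 = - t1 ->
    z3 = - w -> x3 = - w -> y3 = - v -> t3 = - v -> x3 = v.
  by move=> *; lra.
apply: (arith _ _ _ _ _ _ _ _ _ _ _ _ _ _ (B X Y Z T SX SY SZ ST) (B Y Z T X SY SZ ST SX)
  (B Z T X Y SZ ST SX SY) (B T X Y Z ST SX SY SZ) (s34 X Y Z T SX SY SZ ST)
  (s34 Y Z X T SY SZ SX ST) (s34 Z T Y X SZ ST SY SX) (s34 T X Z Y ST SX SZ SY)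
  (s12 X Z T Y SX SZ ST SY) (s34 Z X Y T SZ SX SY ST) (s12 T Y Z X ST SY SZ SX)
  (s34 Y T X Z SY ST SX SZ)).
Qed.

End CurvatureSymmetries.

(** * Products and warped products *)

Section RowBlocks.
Context {R : realType} (m n : nat).
Implicit Types (a x : 'rV[R]_m) (b y : 'rV[R]_n) (u : 'rV[R]_(m + n) -> R).

(** The two difference quotients are equal as functions of t, so no differentiability enters. *)
Lemma partial_lshift u a b i :
  partial (lshift n i) u (row_mx a b) = partial i (fun x => u (row_mx x b)) a.
Proof.
have E (t : R) : t *: delta_mx 0 (lshift n i) + row_mx a b =
    row_mx (t *: delta_mx 0 i + a) b.
  rewrite -[delta_mx 0 (lshift n i)](@hsubmxK _ _ m n) lsubmx_delta rsubmx_delta.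
  by rewrite (unsplitK (inl i)) scale_row_mx add_row_mx scaler0 add0r.
rewrite /partial /derive; set G := fun t : R => _; set H := fun t : R => _.
by have -> : G = H by apply/funext => t; rewrite /G /H /= E.
Qed.

Lemma partial_rshift u a b i :
  partial (rshift m i) u (row_mx a b) = partial i (fun y => u (row_mx a y)) b.
Proof.
have E (t : R) : t *: delta_mx 0 (rshift m i) + row_mx a b =
    row_mx a (t *: delta_mx 0 i + b).
  rewrite -[delta_mx 0 (rshift m i)](@hsubmxK _ _ m n) lsubmx_delta rsubmx_delta.
  by rewrite (unsplitK (inr i)) scale_row_mx add_row_mx scaler0 add0r.
rewrite /partial /derive; set G := fun t : R => _; set H := fun t : R => _.
by have -> : G = H by apply/funext => t; rewrite /G /H /= E.
Qed.

Lemma Ck_row_mxl k (U : set 'rV[R]_m) b j : Ck k U (fun x => row_mx x b 0 j).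
Proof.
case: (split_ordP j) => i ->.
  rewrite (_ : (fun _ => _) = fun x : 'rV[R]_m => x 0 i); first exact: Ck_coord.
  by apply/funext => x; rewrite row_mxEl.
rewrite (_ : (fun _ => _) = cst (b 0 i)); first exact: Ck_cst.
by apply/funext => x; rewrite row_mxEr.
Qed.

Lemma Ck_row_mxr k (U : set 'rV[R]_n) a j : Ck k U (fun y => row_mx a y 0 j).
Proof.
case: (split_ordP j) => i ->.
  rewrite (_ : (fun _ => _) = cst (a 0 i)); first exact: Ck_cst.
  by apply/funext => x; rewrite row_mxEl.
rewrite (_ : (fun _ => _) = fun y : 'rV[R]_n => y 0 i); first exact: Ck_coord.
by apply/funext => x; rewrite row_mxEr.
Qed.

End RowBlocks.

(** * Slices and lifts on a product manifold *)

Section ProductManifold.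
Context {R : realType} (B F : manifold R).
Local Notation P := (prod_manifold B F).
Implicit Types (p : B) (q : F) (Z : vfield P) (h : P -> R).

Lemma vderiv_prod p q (v : 'rV[R]_(mdim P)) h :
  vderiv ((p, q) : P) v h =
  vderiv p (lsubmx (v : 'rV[R]_(mdim B + mdim F))) (fun p' => h (p', q)) +
  vderiv q (rsubmx (v : 'rV[R]_(mdim B + mdim F))) (fun q' => h (p, q')).
Proof.
rewrite /vderiv [LHS](@big_split_ord _ _ _ (mdim B) (mdim F)) /=.
congr (_ + _); apply: eq_bigr => i _; rewrite [in RHS]mxE; congr (_ * _).
  rewrite /prod_chart /= partial_lshift; congr (partial i _ _).
  by apply/funext => x; rewrite /= /prod_param row_mxKl row_mxKr paramK.
rewrite /prod_chart /= partial_rshift; congr (partial i _ _).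
by apply/funext => x; rewrite /= /prod_param row_mxKl row_mxKr paramK.
Qed.

Definition sliceB q Z : vfield B :=
  fun p => lsubmx (Z (p, q) : 'rV[R]_(mdim B + mdim F)).
Definition sliceF p Z : vfield F :=
  fun q => rsubmx (Z (p, q) : 'rV[R]_(mdim B + mdim F)).

Lemma deriv_prod Z h p q :
  deriv Z h (p, q) = deriv (sliceB q Z) (fun p' => h (p', q)) p +
                     deriv (sliceF p Z) (fun q' => h (p, q')) q.
Proof. exact: vderiv_prod. Qed.

Lemma deriv_coord_lshift Z (c : P) i p q :
  deriv Z (coord c (lshift (mdim F) i)) (p, q) = deriv (sliceB q Z) (coord c.1 i) p.
Proof.
rewrite deriv_prod [X in _ + X](_ : _ = 0) ?addr0.
  by congr (deriv _ _ p); apply/funext => p'; rewrite /coord /= /prod_chart row_mxEl.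
rewrite -[RHS](vderiv_cst q (sliceF p Z q) (chart c.1 p 0 i)).
by congr vderiv; apply/funext => q'; rewrite /coord /= /prod_chart row_mxEl.
Qed.

Lemma deriv_coord_rshift Z (c : P) i p q :
  deriv Z (coord c (rshift (mdim B) i)) (p, q) = deriv (sliceF p Z) (coord c.2 i) q.
Proof.
rewrite deriv_prod [X in X + _](_ : _ = 0) ?add0r.
  by congr (deriv _ _ q); apply/funext => q'; rewrite /coord /= /prod_chart row_mxEr.
rewrite -[RHS](vderiv_cst p (sliceB q Z p) (chart c.2 q 0 i)).
by congr vderiv; apply/funext => p'; rewrite /coord /= /prod_chart row_mxEr.
Qed.

Lemma Cinf_sliceB (c p : B) q (u : 'rV[R]_(mdim B + mdim F) -> R) :
  Cinf (chart_img ((c, q) : P)) u ->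
  Cinf (chart_img c) (fun x => u (row_mx x (chart q q))).
Proof.
move=> Cu k.
apply: (@Ck_comp R k _ _ _ _ (fun x => row_mx x (chart q q)) u _ _ _ (Cu k)).
- exact: chart_img_open.
- move=> _ [z cz <-]; exists (z, q) => //.
  by split=> //; exact: chart_dom_center.
- by move=> j; exact: Ck_row_mxl.
Qed.

Lemma Cinf_sliceF (c : F) p (u : 'rV[R]_(mdim B + mdim F) -> R) :
  Cinf (chart_img ((p, c) : P)) u ->
  Cinf (chart_img c) (fun y => u (row_mx (chart p p) y)).
Proof.
move=> Cu k.
apply: (@Ck_comp R k _ _ _ _ (fun y => row_mx (chart p p) y) u _ _ _ (Cu k)).
- exact: chart_img_open.
- move=> _ [z cz <-]; exists (p, z) => //.
  by split=> //; exact: chart_dom_center.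
- by move=> j; exact: Ck_row_mxr.
Qed.

Lemma smooth_sliceB q Z : smooth_vf Z -> smooth_vf (sliceB q Z).
Proof.
move=> sZ c i.
rewrite (_ : _ \o _ = fun x =>
  (deriv Z (coord ((c, q) : P) (lshift (mdim F) i)) \o param ((c, q) : P))
    (row_mx x (chart q q))); first exact: Cinf_sliceB.
apply/funext => x; rewrite /= /prod_param row_mxKl row_mxKr paramK.
by rewrite deriv_coord_lshift.
Qed.

Lemma smooth_sliceF p Z : smooth_vf Z -> smooth_vf (sliceF p Z).
Proof.
move=> sZ c i.
rewrite (_ : _ \o _ = fun y =>
  (deriv Z (coord ((p, c) : P) (rshift (mdim B) i)) \o param ((p, c) : P))
    (row_mx (chart p p) y)); first exact: Cinf_sliceF.
apply/funext => x; rewrite /= /prod_param row_mxKl row_mxKr paramK.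
by rewrite deriv_coord_rshift.
Qed.

(** With q fixed the vectors stay in the single space T_q F, so their components can be
    differentiated along B; such derivatives occur in [X, Z] for X a lift from B. *)
Lemma diff_at_sliceF p q Z j : smooth_vf Z -> diff_at p (fun p' => sliceF p' Z q 0 j).
Proof.
move=> sZ; apply: (@Cinf_differentiable _ _ (chart_img p)); last first.
  by exists p => //; exact: chart_dom_center.
rewrite (_ : _ \o _ = fun x =>
  (deriv Z (coord ((p, q) : P) (rshift (mdim B) j)) \o param ((p, q) : P))
    (row_mx x (chart q q))); first exact: Cinf_sliceB.
apply/funext => x; rewrite /= /prod_param row_mxKl row_mxKr paramK.
by rewrite deriv_coord_rshift /deriv vderiv_coord.
Qed.

Lemma diff_at_sliceB p q Z j : smooth_vf Z -> diff_at q (fun q' => sliceB q' Z p 0 j).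
Proof.
move=> sZ; apply: (@Cinf_differentiable _ _ (chart_img q)); last first.
  by exists q => //; exact: chart_dom_center.
rewrite (_ : _ \o _ = fun y =>
  (deriv Z (coord ((p, q) : P) (lshift (mdim F) j)) \o param ((p, q) : P))
    (row_mx (chart p p) y)); first exact: Cinf_sliceF.
apply/funext => x; rewrite /= /prod_param row_mxKl row_mxKr paramK.
by rewrite deriv_coord_lshift /deriv vderiv_coord.
Qed.

Lemma smooth_fun_fst (h : B -> R) : smooth_fun h -> @smooth_fun R P (fun z => h z.1).
Proof.
move=> sh c k; apply: Ck_sub (Ck_lsubmx (mdim F) (sh c.1 k)).
by rewrite /chart_img /= prod_img => x [].
Qed.

Lemma smooth_fun_snd (h : F -> R) : smooth_fun h -> @smooth_fun R P (fun z => h z.2).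
Proof.
move=> sh c k; apply: Ck_sub (Ck_rsubmx (mdim B) (sh c.2 k)).
by rewrite /chart_img /= prod_img => x [].
Qed.

(** The block form of a lift, kept apart from smoothness so that it passes to brackets without
    further conditions. *)
Definition liftB (X : vfield P) (XB : vfield B) : Prop :=
  forall p q, X (p, q) = row_mx (XB p) 0 :> 'rV[R]_(mdim B + mdim F).
Definition liftF (V : vfield P) (VF : vfield F) : Prop :=
  forall p q, V (p, q) = row_mx 0 (VF q) :> 'rV[R]_(mdim B + mdim F).

Lemma is_lift_B_liftB X XB : is_lift_B X XB -> liftB X XB.
Proof.
move=> [_ _ H] p q; have [H1 [v H2]] := H p q.
rewrite -[LHS](@hsubmxK _ _ (mdim B) (mdim F)); congr row_mx.
  by rewrite -H1 differential_projB.
apply/rowP => j; rewrite H2 !mxE.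
rewrite -[RHS](vderiv_cst p v (chart q q 0 j)).
by congr vderiv; apply/funext => p'; rewrite /coord /= /prod_chart row_mxEr.
Qed.

Lemma is_lift_F_liftF V VF : is_lift_F V VF -> liftF V VF.
Proof.
move=> [_ _ H] p q; have [H1 [v H2]] := H p q.
rewrite -[LHS](@hsubmxK _ _ (mdim B) (mdim F)); congr row_mx; last first.
  by rewrite -H1 differential_projF.
apply/rowP => j; rewrite H2 !mxE.
rewrite -[RHS](vderiv_cst q v (chart p p 0 j)).
by congr vderiv; apply/funext => q'; rewrite /coord /= /prod_chart row_mxEl.
Qed.

Section LiftB.
Variables (X : vfield P) (XB : vfield B) (hX : liftB X XB).

Lemma sliceB_liftB q : sliceB q X = XB.
Proof. by apply/funext => p; rewrite /sliceB hX row_mxKl. Qed.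

Lemma sliceF_liftB p : sliceF p X = 0.
Proof. by apply/funext => q; rewrite /sliceF hX row_mxKr. Qed.

Lemma deriv_liftB h p q : deriv X h (p, q) = deriv XB (fun p' => h (p', q)) p.
Proof. by rewrite deriv_prod sliceB_liftB sliceF_liftB /deriv vderiv0 addr0. Qed.

Lemma sliceB_bracket_liftB Z q : sliceB q (bracket X Z) = bracket XB (sliceB q Z).
Proof.
apply/funext => p; apply/rowP => i; rewrite !mxE; congr (_ - _).
  rewrite deriv_liftB; congr (deriv _ _ p); apply/funext => p'.
  exact: deriv_coord_lshift.
rewrite deriv_prod [X in _ + X](_ : _ = 0) ?addr0.
  congr (deriv _ _ p); apply/funext => p'.
  by rewrite deriv_coord_lshift sliceB_liftB.
rewrite -[RHS](vderiv_cst q (sliceF p Z q) (deriv XB (coord p i) p)).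
congr vderiv; apply/funext => q'.
by rewrite deriv_coord_lshift sliceB_liftB.
Qed.

(** X annihilates the coordinates of F, so only the term X(Z^j) of the commutator survives. *)
Lemma sliceF_bracket_liftB Z p q : sliceF p (bracket X Z) q =
  \row_j vderiv p (XB p) (fun p' => sliceF p' Z q 0 j).
Proof.
apply/rowP => j; rewrite !mxE [X in _ - X](_ : _ = 0) ?subr0.
  rewrite deriv_liftB; congr (deriv _ _ p); apply/funext => p'.
  by rewrite deriv_coord_rshift /deriv vderiv_coord.
have -> : deriv X (coord ((p, q) : P) (rshift (mdim B) j)) = fun=> 0.
  apply/funext => -[p' q'].
  by rewrite deriv_coord_rshift sliceF_liftB /deriv vderiv0.
exact: vderiv_cst.
Qed.

End LiftB.

Section LiftF.
Variables (V : vfield P) (VF : vfield F) (hV : liftF V VF).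

Lemma sliceF_liftF p : sliceF p V = VF.
Proof. by apply/funext => q; rewrite /sliceF hV row_mxKr. Qed.

Lemma sliceB_liftF q : sliceB q V = 0.
Proof. by apply/funext => p; rewrite /sliceB hV row_mxKl. Qed.

Lemma deriv_liftF h p q : deriv V h (p, q) = deriv VF (fun q' => h (p, q')) q.
Proof. by rewrite deriv_prod sliceF_liftF sliceB_liftF /deriv vderiv0 add0r. Qed.

Lemma sliceF_bracket_liftF Z p : sliceF p (bracket V Z) = bracket VF (sliceF p Z).
Proof.
apply/funext => q; apply/rowP => i; rewrite !mxE; congr (_ - _).
  rewrite deriv_liftF; congr (deriv _ _ q); apply/funext => q'.
  exact: deriv_coord_rshift.
rewrite deriv_prod [X in X + _](_ : _ = 0) ?add0r.
  congr (deriv _ _ q); apply/funext => q'.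
  by rewrite deriv_coord_rshift sliceF_liftF.
rewrite -[RHS](vderiv_cst p (sliceB q Z p) (deriv VF (coord q i) q)).
congr vderiv; apply/funext => p'.
by rewrite deriv_coord_rshift sliceF_liftF.
Qed.

Lemma sliceB_bracket_liftF Z p q : sliceB q (bracket V Z) p =
  \row_j vderiv q (VF q) (fun q' => sliceB q' Z p 0 j).
Proof.
apply/rowP => j; rewrite !mxE [X in _ - X](_ : _ = 0) ?subr0.
  rewrite deriv_liftF; congr (deriv _ _ q); apply/funext => q'.
  by rewrite deriv_coord_lshift /deriv vderiv_coord.
have -> : deriv V (coord ((p, q) : P) (lshift (mdim F) j)) = fun=> 0.
  apply/funext => -[p' q'].
  by rewrite deriv_coord_lshift sliceB_liftF /deriv vderiv0.
exact: vderiv_cst.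
Qed.

End LiftF.

Lemma vfieldE Z p q :
  Z (p, q) = row_mx (sliceB q Z p) (sliceF p Z q) :> 'rV[R]_(mdim B + mdim F).
Proof. by rewrite [RHS]hsubmxK. Qed.

Lemma liftB_bracket X XB Y YB : liftB X XB -> liftB Y YB ->
  liftB (bracket X Y) (bracket XB YB).
Proof.
move=> hX hY p q; rewrite vfieldE (sliceB_bracket_liftB hX) (sliceB_liftB hY).
congr row_mx; rewrite (sliceF_bracket_liftB hX); apply/rowP => j; rewrite !mxE.
rewrite -[RHS](vderiv_cst p (XB p) 0); congr vderiv; apply/funext => p'.
by rewrite (sliceF_liftB hY) mxE.
Qed.

Lemma liftF_bracket V VF W WF : liftF V VF -> liftF W WF ->
  liftF (bracket V W) (bracket VF WF).
Proof.
move=> hV hW p q; rewrite vfieldE (sliceF_bracket_liftF hV) (sliceF_liftF hW).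
congr row_mx; rewrite (sliceB_bracket_liftF hV); apply/rowP => j; rewrite !mxE.
rewrite -[RHS](vderiv_cst q (VF q) 0); congr vderiv; apply/funext => q'.
by rewrite (sliceB_liftF hW) mxE.
Qed.

Lemma bracket_liftB_liftF X XB V VF : liftB X XB -> liftF V VF ->
  bracket X V = 0.
Proof.
move=> hX hV; apply/funext => -[p q]; rewrite [LHS]vfieldE.
rewrite (sliceF_bracket_liftB hX) bracketC.
have -> : sliceB q (- bracket V X) p = - sliceB q (bracket V X) p.
  by rewrite /sliceB [LHS]linearN.
rewrite (sliceB_bracket_liftF hV).
apply/rowP => j; rewrite !mxE; case: fintype.split => i; rewrite !mxE.
  under eq_fun do rewrite (sliceB_liftB hX).
  by rewrite vderiv_cst oppr0.
under eq_fun do rewrite (sliceF_liftF hV).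
exact: vderiv_cst.
Qed.

End ProductManifold.

(** * The Koszul form of a warped product *)

Section WarpedKoszul.
Context {R : realType} (B F : srmanifold R) (f : B -> R) (f_smooth : smooth_fun f).
Local Notation WP := (warped_product F f_smooth).
Implicit Types (p : B) (q : F) (X Y Z V W : vfield WP).
Implicit Types (XB YB : vfield B) (VF WF : vfield F).

Lemma metric_warped p q (v w : 'rV[R]_(mdim B + mdim F)) :
  @metric R WP (p, q) v w =
  metric p (lsubmx v) (lsubmx w) + f p ^+ 2 * metric q (rsubmx v) (rsubmx w).
Proof.
by rewrite /metric /= /warped_metric !differential_projB !differential_projF.
Qed.

Lemma ip_warped X Y p q : ip X Y (p, q) =
  ip (sliceB q X) (sliceB q Y) p + f p ^+ 2 * ip (sliceF p X) (sliceF p Y) q.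
Proof. exact: metric_warped. Qed.

Lemma diff_at_f p : diff_at p f.
Proof. exact: smooth_diff_at. Qed.

Lemma diff_at_f2 p : diff_at p (fun p' => f p' ^+ 2).
Proof.
by rewrite (_ : (fun _ => _) = fun p' => f p' * f p'); [apply: diff_atM; exact: diff_at_f|].
Qed.

Lemma vderiv_f2 p v : vderiv p v (fun p' => f p' ^+ 2) = 2 * (f p * vderiv p v f).
Proof.
rewrite [LHS](vderivM v (@diff_at_f p) (@diff_at_f p)).
by rewrite mulr_natl mulr2n.
Qed.

Lemma ip_liftB X XB Z p q : liftB X XB ->
  ip X Z (p, q) = ip XB (sliceB q Z) p.
Proof.
move=> hX; rewrite ip_warped (sliceB_liftB hX) (sliceF_liftB hX) [X in _ + X](_ : _ = 0) ?addr0//.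
by rewrite /ip metric0l mulr0.
Qed.

Lemma ip_liftF V VF Z p q : liftF V VF ->
  ip V Z (p, q) = f p ^+ 2 * ip VF (sliceF p Z) q.
Proof.
move=> hV; rewrite ip_warped (sliceB_liftF hV) (sliceF_liftF hV).
by rewrite [X in X + _](_ : _ = 0) ?add0r// /ip metric0l.
Qed.

Lemma ip_liftB_liftF X XB V VF : liftB X XB -> liftF V VF -> ip X V = fun=> 0.
Proof.
move=> hX hV; apply/funext => -[p q].
by rewrite (ip_liftB _ _ _ hX) (sliceB_liftF hV) /ip metric0r.
Qed.

(** Lifts from B are orthogonal to the F-part of any field, [X, Z] has B-slice [XB, Z_q], and <X, Y>
    is constant along F; so each of the six terms sees only Z_q. *)
Lemma koszul_BB X Y XB YB Z p q : liftB X XB -> liftB Y YB ->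
  koszul X Y Z (p, q) = koszul XB YB (sliceB q Z) p.
Proof.
move=> hX hY; rewrite /koszul; congr (_ * _).
have E1 (A A' : vfield WP) (AB AB' : vfield B) : liftB A AB -> liftB A' AB' ->
    deriv A (ip A' Z) (p, q) = deriv AB (ip AB' (sliceB q Z)) p.
  move=> hA hA'; rewrite (deriv_liftB hA); congr (deriv _ _ p).
  by apply/funext => p'; rewrite (ip_liftB _ _ _ hA').
have E2 (A A' : vfield WP) (AB AB' : vfield B) : liftB A AB -> liftB A' AB' ->
    ip A (bracket A' Z) (p, q) = ip AB (bracket AB' (sliceB q Z)) p.
  by move=> hA hA'; rewrite (ip_liftB _ _ _ hA) (sliceB_bracket_liftB hA').
have E3 : deriv Z (ip X Y) (p, q) = deriv (sliceB q Z) (ip XB YB) p.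
  rewrite deriv_prod [X in _ + X](_ : _ = 0) ?addr0.
    congr (deriv _ _ p); apply/funext => p'.
    by rewrite (ip_liftB _ _ _ hX) (sliceB_liftB hY).
  rewrite -[RHS](vderiv_cst q (sliceF p Z q) (ip XB YB p)); congr vderiv.
  by apply/funext => q'; rewrite (ip_liftB _ _ _ hX) (sliceB_liftB hY).
rewrite (E1 X Y XB YB hX hY) (ipC Z X) (E1 Y X YB XB hY hX) E3 (E2 _ _ _ _ hX hY).
rewrite (bracketC X Z) ipNr (E2 _ _ _ _ hY hX) (ipC Z (bracket X Y)).
rewrite (ip_liftB _ _ _ (liftB_bracket hX hY)).
by rewrite (ipC (sliceB q Z) XB) (bracketC XB (sliceB q Z)) ipNr (ipC (sliceB q Z) (bracket XB YB)).
Qed.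

Lemma koszul_BF X V XB VF Z p q : liftB X XB -> liftF V VF -> smooth_vf Z ->
  koszul X V Z (p, q) = f p * deriv XB f p * metric q (VF q) (sliceF p Z q).
Proof.
move=> hX hV sZ.
(* [lam] follows <V, Z>_F along B with q fixed. [dlam] is the derivative of the F-slice of Z along
   XB and also the F-part of [X, Z], so it cancels between [T1] and [T5]; only the derivative of f^2
   remains. *)
pose lam p' := metric q (VF q) (sliceF p' Z q).
pose dlam := \row_j vderiv p (XB p) (fun p' => sliceF p' Z q 0 j).
have lamE p' : lam p' = \sum_j sliceF p' Z q 0 j * metric q (VF q) (delta_mx 0 j).
  rewrite /lam [X in metric q _ X](row_sum_delta (sliceF p' Z q)) metric_sumr.
  by apply: eq_bigr => j _; rewrite metricZr.
have dl j : diff_at p (fun p' => sliceF p' Z q 0 j * metric q (VF q) (delta_mx 0 j)).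
  by apply: diff_atM; [exact: diff_at_sliceF|exact: diff_at_cst].
have dlamd : diff_at p lam.
  by rewrite (funext lamE); exact: diff_at_sum.
have vlam : vderiv p (XB p) lam = metric q (VF q) dlam.
  rewrite (funext lamE) vderiv_sum// [X in metric q _ X]row_sum_delta metric_sumr.
  apply: eq_bigr => j _; rewrite metricZr mxE vderivM; last 2 first.
  - exact: diff_at_sliceF.
  - exact: diff_at_cst.
  by rewrite vderiv_cst mulr0 add0r mulrC.
have T1 : deriv X (ip V Z) (p, q) =
    f p ^+ 2 * metric q (VF q) dlam + lam p * (2 * (f p * vderiv p (XB p) f)).
  rewrite (deriv_liftB hX) -vlam -vderiv_f2 -[RHS]vderivM//; last exact: diff_at_f2.
  by congr vderiv; apply/funext => p'; rewrite (ip_liftF _ _ _ hV).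
have T2 : deriv V (ip Z X) (p, q) = ip X (bracket V Z) (p, q).
  rewrite (ip_liftB _ _ _ hX) /ip (sliceB_bracket_liftF hV) (deriv_liftF hV).
  rewrite [X in metric p _ X]row_sum_delta metric_sumr.
  pose c j := metric p (XB p) (delta_mx 0 j).
  rewrite [LHS](_ : _ = vderiv q (VF q) (fun q' => \sum_j sliceB q' Z p 0 j * c j)).
    rewrite vderiv_sum => [|j]; last first.
      by apply: diff_atM; [exact: diff_at_sliceB|exact: diff_at_cst].
    apply: eq_bigr => j _; rewrite metricZr mxE vderivM; last 2 first.
    - exact: diff_at_sliceB.
    - exact: diff_at_cst.
    by rewrite vderiv_cst mulr0 add0r mulrC.
  congr vderiv; apply/funext => q'.
  rewrite -[LHS]/(ip Z X (p, q')) ipC (ip_liftB _ _ _ hX) /ip.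
  rewrite [X in metric p _ X](row_sum_delta (sliceB q' Z p)) metric_sumr.
  by apply: eq_bigr => j _; rewrite metricZr.
have T3 : deriv Z (ip X V) (p, q) = 0.
  by rewrite (ip_liftB_liftF hX hV); exact: vderiv_cst.
have T5 : ip V (bracket Z X) (p, q) = - (f p ^+ 2 * metric q (VF q) dlam).
  by rewrite bracketC ipNr (ip_liftF _ _ _ hV) /ip (sliceF_bracket_liftB hX).
have T6 : ip Z (bracket X V) (p, q) = 0.
  by rewrite (bracket_liftB_liftF hX hV); exact: metric0r.
rewrite /koszul T1 T2 T3 T5 T6 /deriv -/(lam p).
move: (ip _ _ _) (metric _ _ _) (lam p) (vderiv _ _ _) (f p) => a b c d e.
by field.
Qed.

Lemma koszul_FB X V XB VF Z p q : liftB X XB -> liftF V VF -> smooth_vf Z ->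
  koszul V X Z (p, q) = f p * deriv XB f p * metric q (VF q) (sliceF p Z q).
Proof.
move=> hX hV sZ; rewrite koszul_torsion (koszul_BF _ _ hX hV)// bracketC.
by rewrite (bracket_liftB_liftF hX hV) oppr0 [ip _ _ _]metric0r addr0.
Qed.

(** Every term treats f(p)^2 as a constant factor except Z<V, W>, where the B-part of Z also
    differentiates f^2; this is the origin of the first summand. *)
Lemma koszul_FF V W VF WF Z p q : liftF V VF -> liftF W WF ->
  smooth_vf VF -> smooth_vf WF -> smooth_vf Z ->
  koszul V W Z (p, q) = - (f p * vderiv p (sliceB q Z p) f * ip VF WF q) +
                        f p ^+ 2 * koszul VF WF (sliceF p Z) q.
Proof.
move=> hV hW sV sW sZ.
have sZF := smooth_sliceF p sZ.
have dip (A A' : vfield F) : smooth_vf A -> smooth_vf A' -> diff_at q (ip A A').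
  by move=> sA sA'; apply: smooth_diff_at; exact: smooth_ip.
have E1 (A A' : vfield WP) (AF AF' : vfield F) : liftF A AF -> liftF A' AF' -> smooth_vf AF' ->
    deriv A (ip A' Z) (p, q) = f p ^+ 2 * deriv AF (ip AF' (sliceF p Z)) q.
  move=> hA hA' sA'; rewrite (deriv_liftF hA) -[RHS]vderivZ; last exact: dip.
  by congr vderiv; apply/funext => q'; rewrite (ip_liftF _ _ _ hA').
have E2 (A A' : vfield WP) (AF AF' : vfield F) : liftF A AF -> liftF A' AF' ->
    ip A (bracket A' Z) (p, q) = f p ^+ 2 * ip AF (bracket AF' (sliceF p Z)) q.
  by move=> hA hA'; rewrite (ip_liftF _ _ _ hA) (sliceF_bracket_liftF hA').
have E3 : deriv Z (ip V W) (p, q) =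
    2 * (f p * vderiv p (sliceB q Z p) f) * ip VF WF q +
    f p ^+ 2 * deriv (sliceF p Z) (ip VF WF) q.
  rewrite deriv_prod; congr (_ + _).
    rewrite -vderiv_f2 mulrC -[RHS]vderivZ; last exact: diff_at_f2.
    congr vderiv; apply/funext => p'.
    by rewrite (ip_liftF _ _ _ hV) (sliceF_liftF hW) mulrC.
  rewrite -[RHS]vderivZ; last exact: dip.
  congr vderiv; apply/funext => q'.
  by rewrite (ip_liftF _ _ _ hV) (sliceF_liftF hW).
rewrite /koszul (E1 V W VF WF hV hW sW) (ipC Z V) (E1 W V WF VF hW hV sV) E3.
rewrite (E2 V W VF WF hV hW) (bracketC V Z) ipNr (E2 W V WF VF hW hV).
rewrite (ipC Z (bracket V W)) (ip_liftF _ _ _ (liftF_bracket hV hW)).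
rewrite (ipC (sliceF p Z) VF) (bracketC VF (sliceF p Z)) ipNr.
rewrite (ipC (sliceF p Z) (bracket VF WF)).
move: (deriv VF _ q) (deriv WF _ q) (deriv (sliceF p Z) _ q) => a1 a2 a3.
move: (ip VF (bracket _ _) q) (ip WF (bracket _ _) q) (ip (bracket _ _) _ q) => b1 b2 b3.
move: (vderiv _ _ _) (ip VF WF q) (f p) => c d e.
by field.
Qed.

End WarpedKoszul.

(** * The curvature of a warped product, block by block *)

Section WarpedCurvature.
Context {R : realType} (B F : srmanifold R) (f : B -> R) (f_smooth : smooth_fun f).
Hypotheses (B_sr : semi_regular B) (F_sr : semi_regular F).
Hypothesis df_bullet1 : bullet1 (dform f).
Local Notation WP := (warped_product F f_smooth).
Implicit Types (p : B) (q : F) (X Y Z T U V W Q : vfield WP).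
Implicit Types (XB YB ZB TB : vfield B) (UF VF WF QF : vfield F).
Implicit Types (A C : vfield WP) (AB : vfield B) (AF CF : vfield F).

Lemma represents_BB X XB Y YB p q v : liftB X XB -> liftB Y YB ->
  represents p v (nabla_flat XB YB) ->
  represents ((p, q) : WP) (row_mx v 0 : 'rV[R]_(mdim B + mdim F)) (nabla_flat X Y).
Proof.
move=> hX hY rv Z sZ; rewrite /nabla_flat (koszul_BB _ _ _ hX hY).
rewrite metric_warped row_mxKl row_mxKr metric0l mulr0 addr0.
exact: rv (smooth_sliceB q sZ).
Qed.

(* Also correct where f vanishes, since then f^-1 = 0. *)
Lemma represents_BF X XB V VF p q : liftB X XB -> liftF V VF ->
  represents ((p, q) : WP)
    (row_mx 0 (((f p)^-1 * deriv XB f p) *: VF q) : 'rV[R]_(mdim B + mdim F))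
    (nabla_flat X V).
Proof.
move=> hX hV Z sZ; rewrite /nabla_flat (koszul_BF _ _ hX hV)//.
rewrite metric_warped row_mxKl row_mxKr metric0l add0r metricZl /sliceF.
have [->|f0] := eqVneq (f p) 0; first by rewrite expr0n /= !mul0r.
by rewrite !mulrA; congr (_ * _ * _); rewrite expr2 -mulrA divff// mulr1.
Qed.

Lemma represents_FB X XB V VF p q : liftB X XB -> liftF V VF ->
  represents ((p, q) : WP)
    (row_mx 0 (((f p)^-1 * deriv XB f p) *: VF q) : 'rV[R]_(mdim B + mdim F))
    (nabla_flat V X).
Proof.
move=> hX hV Z sZ; rewrite /nabla_flat (koszul_FB _ _ hX hV)//.
rewrite -(koszul_BF p q hX hV sZ).
exact: represents_BF.
Qed.

Lemma represents_FF V VF W WF p q g w : liftF V VF -> liftF W WF ->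
  smooth_vf VF -> smooth_vf WF ->
  represents p g (dform f) -> represents q w (nabla_flat VF WF) ->
  represents ((p, q) : WP)
    (row_mx (- (f p * ip VF WF q) *: g) w : 'rV[R]_(mdim B + mdim F))
    (nabla_flat V W).
Proof.
move=> hV hW sV sW rg rw Z sZ; rewrite /nabla_flat (koszul_FF p q hV hW sV sW sZ).
rewrite metric_warped row_mxKl row_mxKr metricZl; congr (_ + _ * _).
  have <- := rg _ (smooth_sliceB q sZ).
  by rewrite mulrAC mulNr.
exact: rw (smooth_sliceF p sZ).
Qed.

Lemma grad_exists p : exists g, represents p g (dform f).
Proof. by have [[_ H] _] := df_bullet1; exact: H. Qed.

Lemma nabla_flat_represented (M : srmanifold R) (G H : vfield M) z :
  semi_regular M -> smooth_vf G -> smooth_vf H ->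
  exists v, represents z v (nabla_flat G H).
Proof. by move=> [rs _] sG sH; have [_ ] := rs _ _ sG sH; exact. Qed.

(** Supplies the representability hypothesis of [riemann_pair_sym], for lifts only and point by
    point. *)
Lemma lift_represented (A A' : vfield WP) z : is_lift A -> is_lift A' ->
  exists v, represents z v (nabla_flat A A').
Proof.
case: z => p q [[AB hA]|[AF hA]] [[AB' hA']|[AF' hA']].
- have [sA _ _] := hA; have [sA' _ _] := hA'.
  have [v rv] := nabla_flat_represented p B_sr sA sA'.
  by eexists; exact: represents_BB (is_lift_B_liftB hA) (is_lift_B_liftB hA') rv.
- by eexists; exact: represents_BF (is_lift_B_liftB hA) (is_lift_F_liftF hA').
- by eexists; exact: represents_FB (is_lift_B_liftB hA') (is_lift_F_liftF hA).
have [sA _ _] := hA; have [sA' _ _] := hA'.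
have [w rw] := nabla_flat_represented q F_sr sA sA'; have [g rg] := grad_exists p.
eexists.
exact: represents_FF (is_lift_F_liftF hA) (is_lift_F_liftF hA') sA sA' rg rw.
Qed.

Lemma smooth_is_lift (A : vfield WP) : is_lift A -> smooth_vf A.
Proof. by move=> [] [? []]. Qed.

Variables (X Y Z T : vfield WP) (XB YB ZB TB : vfield B).
Hypotheses (hX : liftB X XB) (hY : liftB Y YB) (hZ : liftB Z ZB) (hT : liftB T TB).
Hypothesis sT : smooth_vf T.
Hypotheses (sXB : smooth_vf XB) (sYB : smooth_vf YB).
Hypotheses (sZB : smooth_vf ZB) (sTB : smooth_vf TB).
Variables (U V W Q : vfield WP) (UF VF WF QF : vfield F).
Hypotheses (hU : liftF U UF) (hV : liftF V VF) (hW : liftF W WF) (hQ : liftF Q QF).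
Hypothesis sQ : smooth_vf Q.
Hypotheses (sUF : smooth_vf UF) (sVF : smooth_vf VF).
Hypotheses (sWF : smooth_vf WF) (sQF : smooth_vf QF).

Let repB p AB AB' : smooth_vf AB -> smooth_vf AB' ->
  exists v, represents p v (nabla_flat AB AB').
Proof. exact: nabla_flat_represented. Qed.

Let repF q AF AF' : smooth_vf AF -> smooth_vf AF' ->
  exists v, represents q v (nabla_flat AF AF').
Proof. exact: nabla_flat_represented. Qed.

Lemma bullet_ip_BBBB (A1 A2 A3 A4 : vfield WP) (A1B A2B A3B A4B : vfield B) p q :
  liftB A1 A1B -> liftB A2 A2B -> liftB A3 A3B -> liftB A4 A4B ->
  smooth_vf A1B -> smooth_vf A2B -> smooth_vf A3B -> smooth_vf A4B ->
  bullet_ip (nabla_flat A1 A2) (nabla_flat A3 A4) (p, q) =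
  bullet_ip (nabla_flat A1B A2B) (nabla_flat A3B A4B) p.
Proof.
move=> h1 h2 h3 h4 s1 s2 s3 s4.
have [v rv] := repB p s1 s2; have [w rw] := repB p s3 s4.
rewrite (bullet_ip_eq (represents_BB q h1 h2 rv) (represents_BB q h3 h4 rw)).
rewrite (bullet_ip_eq rv rw) metric_warped !row_mxKl !row_mxKr metric0l.
by rewrite mulr0 addr0.
Qed.

Lemma riemann_BBBB p q : riemann X Y Z T (p, q) = riemann XB YB ZB TB p.
Proof.
have E A A' A'' AB AB' AB'' : liftB A AB -> liftB A' AB' -> liftB A'' AB'' ->
    deriv A (koszul A' A'' T) (p, q) = deriv AB (koszul AB' AB'' TB) p.
  move=> hA hA' hA''; rewrite (deriv_liftB hA); congr (deriv _ _ p).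
  by apply/funext => p'; rewrite (koszul_BB _ _ _ hA' hA'') (sliceB_liftB hT).
rewrite (riemannE XB); apply: riemann_eq.
- exact: E.
- exact: bullet_ip_BBBB.
- exact: E.
- exact: bullet_ip_BBBB.
by rewrite (koszul_BB _ _ _ (liftB_bracket hX hY) hZ) (sliceB_liftB hT).
Qed.

(** The B-slice of Q is zero, which kills the Koszul terms; each product pairs a vector (0, _) with
    a vector (_, 0). *)
Lemma riemann_BBBF p q : riemann X Y Z Q (p, q) = 0.
Proof.
have k0 A A' AB AB' : liftB A AB -> liftB A' AB' -> koszul A A' Q = fun=> 0.
  move=> hA hA'; apply/funext => -[p' q']; rewrite (koszul_BB _ _ _ hA hA').
  by rewrite (sliceB_liftF hQ) koszul0r.
have d0 A A' A'' AB' AB'' : liftB A' AB' -> liftB A'' AB'' ->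
    deriv A (koszul A' A'' Q) (p, q) = 0.
  by move=> hA' hA''; rewrite (k0 _ _ _ _ hA' hA''); exact: vderiv_cst.
have b0 A A' A'' AB AB' AB'' : liftB A AB -> liftB A' AB' -> liftB A'' AB'' ->
    smooth_vf AB' -> smooth_vf AB'' ->
    bullet_ip (nabla_flat A Q) (nabla_flat A' A'') (p, q) = 0.
  move=> hA hA' hA'' s' s''; have [v rv] := repB p s' s''.
  rewrite (bullet_ip_eq (represents_BF p q hA hQ) (represents_BB q hA' hA'' rv)).
  by rewrite metric_warped !row_mxKl !row_mxKr metric0l metric0r mulr0 addr0.
rewrite (riemann_eq (d0 X _ _ _ _ hY hZ) (b0 _ _ _ _ _ _ hX hY hZ sYB sZB)
  (d0 Y _ _ _ _ hX hZ) (b0 _ _ _ _ _ _ hY hX hZ sXB sZB) (k := 0)) ?subr0//.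
by rewrite (k0 _ _ _ _ (liftB_bracket hX hY) hZ).
Qed.

Lemma diff_at_df p AB : smooth_vf AB -> diff_at p (deriv AB f).
Proof. by move=> sA; apply: smooth_diff_at; exact: smooth_deriv. Qed.

(** The indicator is the value of f^2 f^-1 f^-1 under 0^-1 = 0: at a zero of f both covectors
    vanish, and so does their product, whatever df is there. The disjunctions cover both orders of
    the arguments at once. *)
Lemma bullet_ip_BFBF A A' AB AB' C C' CF CF' p q omega tau :
  liftB A AB -> liftB A' AB' -> liftF C CF -> liftF C' CF' ->
  omega = nabla_flat A C \/ omega = nabla_flat C A ->
  tau = nabla_flat A' C' \/ tau = nabla_flat C' A' ->
  bullet_ip omega tau ((p, q) : WP) =
  (f p != 0)%:R * (deriv AB f p * deriv AB' f p * ip CF CF' q).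
Proof.
move=> hA hA' hC hC' om ta.
have rom : represents ((p, q) : WP)
    (row_mx 0 (((f p)^-1 * deriv AB f p) *: CF q) : 'rV[R]_(mdim B + mdim F)) omega.
  by case: om => ->; [exact: represents_BF|exact: represents_FB].
have rta : represents ((p, q) : WP)
    (row_mx 0 (((f p)^-1 * deriv AB' f p) *: CF' q) : 'rV[R]_(mdim B + mdim F)) tau.
  by case: ta => ->; [exact: represents_BF|exact: represents_FB].
rewrite (bullet_ip_eq rom rta) metric_warped !row_mxKl !row_mxKr metric0l add0r.
rewrite metricZl metricZr -/(ip CF CF' q).
move: (ip CF CF' q) (deriv AB f p) (deriv AB' f p) => a b c.
have [->|f0] /= := eqVneq (f p) 0; first by rewrite expr0n /= !mul0r.
by field.
Qed.

Lemma deriv_BFf A AB AB' (k : F -> R) p q : liftB A AB -> smooth_vf AB' ->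
  deriv A (fun z : WP => f z.1 * deriv AB' f z.1 * k z.2) (p, q) =
  (f p * deriv AB (deriv AB' f) p + deriv AB' f p * deriv AB f p) * k q.
Proof.
move=> hA sA'; rewrite (deriv_liftB hA) /=.
have d1 := diff_at_f f_smooth p; have d2 := diff_at_df p sA'.
rewrite [LHS](vderivM _ (diff_atM d1 d2) (diff_at_cst _ _)).
by rewrite vderiv_cst mulr0 add0r mulrC; congr (_ * _); exact: vderivM.
Qed.

(** Both products carry the same indicator times X(f) Y(f), symmetric in X and Y, so they cancel
    even at zeros of f; the second derivatives of f cancel against [X, Y](f). *)
Lemma riemann_BBFF p q : riemann X Y W Q (p, q) = 0.
Proof.
have kE A AB : liftB A AB ->
    koszul A W Q = fun z : WP => f z.1 * deriv AB f z.1 * ip WF QF z.2.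
  move=> hA; apply/funext => -[p' q'].
  by rewrite (koszul_BF _ _ hA hW sQ) (sliceF_liftF hQ).
have dE A A' AB AB' : liftB A AB -> liftB A' AB' -> smooth_vf AB' ->
    deriv A (koszul A' W Q) (p, q) =
    (f p * deriv AB (deriv AB' f) p + deriv AB' f p * deriv AB f p) * ip WF QF q.
  by move=> hA hA' sA'; rewrite (kE _ _ hA'); exact: deriv_BFf.
have kXY : koszul (bracket X Y) W Q (p, q) =
    f p * (deriv XB (deriv YB f) p - deriv YB (deriv XB f) p) * ip WF QF q.
  rewrite (kE _ _ (liftB_bracket hX hY)) /=; congr (_ * _ * _).
  by apply: (deriv_bracket (@openT B) I sXB sYB); exact: smooth_fun_on.
have bE A A' AB AB' : liftB A AB -> liftB A' AB' ->
    bullet_ip (nabla_flat A Q) (nabla_flat A' W) (p, q) =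
    (f p != 0)%:R * (deriv AB f p * deriv AB' f p * ip QF WF q).
  by move=> hA hA'; apply: (bullet_ip_BFBF p q hA hA' hQ hW); left.
rewrite (riemann_eq (dE _ _ _ _ hX hY sYB) (bE _ _ _ _ hX hY) (dE _ _ _ _ hY hX sXB)
  (bE _ _ _ _ hY hX) kXY).
move: (deriv XB (deriv YB f) p) (deriv YB (deriv XB f) p) (deriv XB f p) (deriv YB f p).
move: (f p) (ip WF QF q) (ip QF WF q) (f p != 0)%:R => a b c d e1 e2 e3 e4.
by ring.
Qed.

(** Differentiating K(V, W, T) = - f T(f) <V, W>_F along X gives - f X(T f) and an unwanted - X(f)
    T(f). The product [b2] removes the latter, while [b1] completes X(T f) to the Hessian. *)
Lemma riemann_BFFB p q : f p != 0 \/ (forall v, vderiv p v f = 0) ->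
  riemann X V W T (p, q) = - f p * hessian f XB TB p * ip VF WF q.
Proof.
move=> cond.
have dVWT : deriv X (koszul V W T) (p, q) =
    (f p * deriv XB (deriv TB f) p + deriv TB f p * deriv XB f p) * - ip VF WF q.
  have -> : koszul V W T = fun z : WP => f z.1 * deriv TB f z.1 * - ip VF WF z.2.
    apply/funext => -[p' q']; rewrite (koszul_FF _ _ hV hW)// (sliceB_liftB hT).
    by rewrite (sliceF_liftB hT) /= mulrN koszul0r mulr0 addr0.
  exact: (deriv_BFf (fun q => - ip VF WF q)).
have dXWT : deriv V (koszul X W T) (p, q) = 0.
  rewrite [X in deriv _ X _](_ : _ = fun=> 0); first exact: vderiv_cst.
  apply/funext => -[p' q']; rewrite (koszul_BF _ _ hX hW)// (sliceF_liftB hT).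
  by rewrite metric0r mulr0.
have [g rg] := grad_exists p; have [w rw] := repF q sVF sWF; have [v rv] := repB p sXB sTB.
have b1 : bullet_ip (nabla_flat X T) (nabla_flat V W) (p, q) =
    - (f p * ip VF WF q) * metric p v g.
  rewrite (bullet_ip_eq (represents_BB q hX hT rv) (represents_FF hV hW sVF sWF rg rw)).
  by rewrite metric_warped !row_mxKl !row_mxKr metric0l mulr0 addr0 metricZr.
have b2 : bullet_ip (nabla_flat V T) (nabla_flat X W) (p, q) =
    deriv TB f p * deriv XB f p * ip VF WF q.
  (* The only use of [cond]: either the indicator is 1, or X(f) T(f) is itself zero. *)
  rewrite [LHS](bullet_ip_BFBF p q hT hX hV hW); [|by right|by left].
  case: cond => [->|H]; first by rewrite mul1r.
  by rewrite /deriv H !mul0r mulr0.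
have k0 : koszul (bracket X V) W T (p, q) = 0.
  by rewrite (bracket_liftB_liftF hX hV) koszul0l.
rewrite (riemann_eq dVWT b1 dXWT b2 k0) /hessian /nabla (bullet_ip_eq rv rg) /dform.
move: (deriv XB (deriv TB f) p) (deriv XB f p) (deriv TB f p) (ip VF WF q).
move: (metric p v g) (f p) => a b c d e h.
by ring.
Qed.

Lemma deriv_FFf A AF (a : B -> R) (k : F -> R) p q :
  liftF A AF -> diff_at q k ->
  deriv A (fun z : WP => a z.1 * k z.2) (p, q) = a p * deriv AF k q.
Proof. by move=> hA dk; rewrite (deriv_liftF hA) /=; exact: vderivZ. Qed.

(** All five terms share the factor f Z(f). By metric compatibility the cofactor becomes K_F(U, V,
    Q) - K_F(V, U, Q) - <[U, V], Q>_F, which is zero by torsion. *)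
Lemma riemann_FFBF p q : riemann U V Z Q (p, q) = 0.
Proof.
have kE A AF : liftF A AF -> koszul A Z Q =
    fun z : WP => (f z.1 * deriv ZB f z.1) * ip AF QF z.2.
  move=> hA; apply/funext => -[p' q'].
  by rewrite (koszul_FB _ _ hZ hA sQ) (sliceF_liftF hQ).
have dE A A' AF AF' : liftF A AF -> liftF A' AF' -> smooth_vf AF' ->
    deriv A (koszul A' Z Q) (p, q) = (f p * deriv ZB f p) * deriv AF (ip AF' QF) q.
  move=> hA hA' sA'; rewrite (kE _ _ hA').
  apply: (deriv_FFf (fun p' => f p' * deriv ZB f p') p hA).
  by apply: smooth_diff_at; exact: smooth_ip.
have bE A A' AF AF' : liftF A AF -> liftF A' AF' -> smooth_vf AF -> smooth_vf AF' ->
    bullet_ip (nabla_flat A Q) (nabla_flat A' Z) (p, q) =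
    f p * deriv ZB f p * koszul AF QF AF' q.
  move=> hA hA' sA sA'.
  have [g rg] := grad_exists p; have [w rw] := repF q sA sQF.
  rewrite (bullet_ip_eq (represents_FF hA hQ sA sQF rg rw) (represents_FB p q hZ hA')).
  rewrite metric_warped !row_mxKl !row_mxKr metric0r add0r metricZr.
  rewrite [koszul _ _ _ _](rw _ sA').
  move: (metric q w (AF' q)) (deriv ZB f p) => a b.
  have [->|f0] := eqVneq (f p) 0; first by rewrite expr0n /= !mul0r.
  by field.
have kUV : koszul (bracket U V) Z Q (p, q) =
    f p * deriv ZB f p * ip (bracket UF VF) QF q.
  by rewrite (kE _ _ (liftF_bracket hU hV)).
rewrite (riemann_eq (dE _ _ _ _ hU hV sVF) (bE _ _ _ _ hU hV sUF sVF)
  (dE _ _ _ _ hV hU sUF) (bE _ _ _ _ hV hU sVF sUF) kUV).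
have arith (c d1 d2 k1 k2 k3 k4 i : R) : k1 + k2 = d1 -> k3 + k4 = d2 -> k1 = k3 + i ->
    c * d1 - c * k2 - (c * d2 - c * k4) - c * i = 0.
  by move=> <- <- ->; ring.
apply: (arith _ _ _ _ _ _ _ _ (koszul_metric _ _ _ _) (koszul_metric _ _ _ _)).
by rewrite koszul_torsion (ipC QF).
Qed.

(** This is the Gauss equation of the fibre: the B-component - f <V, W>_F grad f of the representing
    vectors acts as second fundamental form, and its products give the terms in <<df, df>>. *)
Lemma riemann_FFFF p q : riemann U V W Q (p, q) =
  f p ^+ 2 * riemann UF VF WF QF q +
  f p ^+ 2 * bullet_ip (dform f) (dform f) p *
  (ip UF WF q * ip VF QF q - ip VF WF q * ip UF QF q).
Proof.
have kE A A' AF AF' : liftF A AF -> liftF A' AF' -> smooth_vf AF -> smooth_vf AF' ->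
    koszul A A' Q = fun z : WP => f z.1 ^+ 2 * koszul AF AF' QF z.2.
  move=> hA hA' sA sA'; apply/funext => -[p' q'].
  rewrite (koszul_FF _ _ hA hA')// (sliceB_liftF hQ) (sliceF_liftF hQ) [vderiv _ _ _]vderiv0.
  by rewrite mulr0 mul0r oppr0 add0r.
have dE A A' A'' AF AF' AF'' : liftF A AF -> liftF A' AF' -> liftF A'' AF'' ->
    smooth_vf AF' -> smooth_vf AF'' ->
    deriv A (koszul A' A'' Q) (p, q) = f p ^+ 2 * deriv AF (koszul AF' AF'' QF) q.
  move=> hA hA' hA'' sA' sA''; rewrite (kE _ _ _ _ hA' hA'' sA' sA'').
  by apply: (deriv_FFf (fun p' => f p' ^+ 2) p hA); exact: diff_at_koszul.
have [g rg] := grad_exists p.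
have bE A A' C C' AF AF' CF CF' :
    liftF A AF -> liftF A' AF' -> liftF C CF -> liftF C' CF' ->
    smooth_vf AF -> smooth_vf AF' -> smooth_vf CF -> smooth_vf CF' ->
    bullet_ip (nabla_flat A A') (nabla_flat C C') (p, q) =
    f p ^+ 2 * bullet_ip (nabla_flat AF AF') (nabla_flat CF CF') q +
    f p ^+ 2 * bullet_ip (dform f) (dform f) p * (ip AF AF' q * ip CF CF' q).
  move=> hA hA' hC hC' sA sA' sC sC'.
  have [v rv] := repF q sA sA'; have [w rw] := repF q sC sC'.
  rewrite (bullet_ip_eq (represents_FF hA hA' sA sA' rg rv) (represents_FF hC hC' sC sC' rg rw)).
  rewrite (bullet_ip_eq rv rw) (bullet_ip_eq rg rg).
  rewrite metric_warped !row_mxKl !row_mxKr metricZl metricZr.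
  move: (metric p g g) (metric q v w) (ip AF AF' q) (ip CF CF' q) (f p) => a b c d e.
  by ring.
have kUV : koszul (bracket U V) W Q (p, q) = f p ^+ 2 * koszul (bracket UF VF) WF QF q.
  by rewrite (kE _ _ _ _ (liftF_bracket hU hV) hW)//; exact: smooth_vf_bracket.
rewrite (riemann_eq (dE _ _ _ _ _ _ hU hV hW sVF sWF)
  (bE _ _ _ _ _ _ _ _ hU hQ hV hW sUF sQF sVF sWF)
  (dE _ _ _ _ _ _ hV hU hW sUF sWF)
  (bE _ _ _ _ _ _ _ _ hV hQ hU hW sVF sQF sUF sWF) kUV) (riemannE UF).
have arith (a b c1 c2 c3 c4 d1 d2 d3 e1 e2 : R) :
    a * d1 - (a * e1 + a * b * (c1 * c2)) - (a * d2 - (a * e2 + a * b * (c3 * c4))) - a * d3 =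
    a * (d1 - e1 - (d2 - e2) - d3) + a * b * (c4 * c3 - c2 * c1).
  by ring.
exact: arith.
Qed.

End WarpedCurvature.

(* In the last formula R_F is the pullback of the curvature of (F, g_F), whence
   its factor f^2 (curvature of the fibre with its induced metric f(p)^2 g_F).
   The formula for R(X, V, W, T) is pointwise wherever f <> 0 or df = 0; at the
   other points (f = 0 and df <> 0, a set with dense complement) the covector
   <W, .> of the warped metric degenerates, and the formula says that its right
   hand side is the smooth extension of R(X, V, W, T). *)
Theorem theorem5p2 (R : realType) (B F : srmanifold R)
  (B_sr : semi_regular B) (F_sr : semi_regular F)
  (f : B -> R) (f_smooth : smooth_fun f) (df_bullet1 : bullet1 (dform f))
  (X Y Z T U V W Q : vfield (warped_product F f_smooth))
  (XB YB ZB TB : vfield B) (UF VF WF QF : vfield F)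
  (hX : is_lift_B X XB) (hY : is_lift_B Y YB)
  (hZ : is_lift_B Z ZB) (hT : is_lift_B T TB)
  (hU : is_lift_F U UF) (hV : is_lift_F V VF)
  (hW : is_lift_F W WF) (hQ : is_lift_F Q QF) :
  [/\ (forall (p : B) (q : F),
         riemann X Y Z T (p, q) = riemann XB YB ZB TB p),
      (forall (p : B) (q : F), riemann X Y Z Q (p, q) = 0),
      (forall (p : B) (q : F), riemann X Y W Q (p, q) = 0) &
      (forall (p : B) (q : F), riemann U V Z Q (p, q) = 0)] /\
  [/\ @smooth_fun R (warped_product F f_smooth) (fun z : B * F =>
        - f z.1 * hessian f XB TB z.1 * ip VF WF z.2) /\
      (forall (p : B) (q : F), f p != 0 \/ (forall v, vderiv p v f = 0) ->
         riemann X V W T (p, q) = - f p * hessian f XB TB p * ip VF WF q),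
      (forall (p : B) (q : F),
         riemann U V W Q (p, q) =
           f p ^+ 2 * riemann UF VF WF QF q +
           f p ^+ 2 * bullet_ip (dform f) (dform f) p *
             (ip UF WF q * ip VF QF q - ip VF WF q * ip UF QF q)) &
      (forall A1 A2 A3 A4 : vfield (warped_product F f_smooth),
         is_lift A1 -> is_lift A2 -> is_lift A3 -> is_lift A4 ->
         forall z,
         [/\ riemann A1 A2 A3 A4 z = - riemann A2 A1 A3 A4 z,
             riemann A1 A2 A3 A4 z = - riemann A1 A2 A4 A3 z &
             riemann A1 A2 A3 A4 z = riemann A3 A4 A1 A2 z])].
Proof.
have [lX lY lZ lT] := And4 (is_lift_B_liftB hX) (is_lift_B_liftB hY)
  (is_lift_B_liftB hZ) (is_lift_B_liftB hT).
have [lU lV lW lQ] := And4 (is_lift_F_liftF hU) (is_lift_F_liftF hV)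
  (is_lift_F_liftF hW) (is_lift_F_liftF hQ).
have [[sXB _ _] [sYB _ _] [sZB _ _] [sTB sT _]] := And4 hX hY hZ hT.
have [[sUF _ _] [sVF _ _] [sWF _ _] [sQF sQ _]] := And4 hU hV hW hQ.
split; split.
- exact (riemann_BBBB B_sr lX lY lZ lT sXB sYB sZB sTB).
- exact (riemann_BBBF B_sr lX lY lZ sXB sYB sZB lQ).
- exact (riemann_BBFF lX lY sXB sYB lW lQ sQ).
- exact (riemann_FFBF F_sr df_bullet1 lZ lU lV lQ sQ sUF sVF sQF).
- split; last exact (riemann_BFFB B_sr F_sr df_bullet1 lX lT sT sXB sTB lV lW sVF sWF).
  (* [df_bullet1] makes the covariant derivative of df along XB a smooth form; its value on TB is
     the Hessian, whose smoothness is thus known on all of B, zeros of f included. *)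
  have [_ /(_ XB sXB) [[sH _] _]] := df_bullet1.
  have sB : smooth_on setT (fun p => - f p * hessian f XB TB p).
    rewrite (_ : (fun p => _) = fun p => -1 * f p * hessian f XB TB p).
      apply: (smooth_onM (@openT B)); last exact: smooth_fun_on (sH TB sTB).
      apply: (smooth_onM (@openT B)); [exact: smooth_on_cst|exact: smooth_fun_on].
    by apply/funext => p; rewrite mulN1r.
  apply: smooth_onT; apply: (smooth_onM openT); apply: smooth_fun_on.
    exact: (smooth_fun_fst (smooth_onT sB)).
  exact: (smooth_fun_snd (smooth_ip sVF sWF)).
- exact (riemann_FFFF F_sr df_bullet1 lU lV lW lQ sQ sUF sVF sWF sQF).
move=> A1 A2 A3 A4 h1 h2 h3 h4 z.
have [s1 s2 s3 s4] := And4 (smooth_is_lift h1) (smooth_is_lift h2)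
  (smooth_is_lift h3) (smooth_is_lift h4).
split.
- exact: riemann_skew12 s1 s2 s3 s4.
- exact: riemann_skew34 s1 s2 s3 s4.
pose S : set (vfield (warped_product F f_smooth)) := @is_lift R B F.
have Ss A : S A -> smooth_vf A := @smooth_is_lift R B F f f_smooth A.
have Sr A A' (SA : S A) (SA' : S A') := lift_represented B_sr F_sr df_bullet1 z SA SA'.
exact (riemann_pair_sym Ss Sr h1 h2 h3 h4).
Qed.
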